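(* Let $p>2$ and let $L_{w,p}=L_{w,p}[0,1]$ be a Lorentz space on $[0,1]$. Then there exists a constant $\varrho_p>1$, depending only on $p$, such that for every nontrivial projection $P$ (i.e. $P\neq \mathrm{Id}$) from $L_{w,p}$ onto a rich subspace of $L_{w,p}$, $$\|P\|\ \ge\ \varrho_p .$$
   Context: Scalars are real or complex (the result is asserted in both cases). $\mu$ is Lebesgue measure on $[0,1]$. Lorentz space: for a measurable function $f$ on $[0,1]$, the non-increasing rearrangement is $f^*(t)=\inf\{s:\mu(|f|>s)\le t\}$. For $1\le p<\infty$ and a non-increasing weight $w:(0,1)\to(0,\infty)$, put $\|f\|_{w,p}=\left(\int_{[0,1]} w(t) f^*(t)^p\,dt\right)^{1/p}$; $L_{w,p}$ (also written $L_{p,w}$) is the space of (classes of) measurable $f$ with $\|f\|_{w,p}<\infty$. Rich subspace: a (closed) subspace $Y\subset X=L_{w,p}$ is rich if for every measurable set $A\subseteq[0,1]$ and every $\varepsilon>0$ there exist $y\in Y$ and $x\in X$ with $x^2=\chi_A$, $\int x\,d\mu=0$ and $\|x-y\|<\varepsilon$ (equivalently, the quotient map $X\to X/Y$ is a narrow operator). A projection is a bounded linear idempotent operator; ''onto $Y$'' means its range is $Y$. *)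

(* Defs.v *)
From mathcomp Require Import all_boot all_order all_algebra.
From mathcomp Require Import all_classical all_reals all_analysis.
From mathcomp Require Import complex.

Set Implicit Arguments.
Unset Strict Implicit.
Unset Printing Implicit Defensive.

Import Order.TTheory GRing.Theory Num.Theory.
Import numFieldNormedType.Exports.

Local Open Scope classical_set_scope.
Local Open Scope ring_scope.

Inductive scalar_kind := real_scalars | complex_scalars.

Definition scalar_field (R : realType) (k : scalar_kind) : numFieldType :=
  match k with
  | real_scalars => R
  | complex_scalars => R[i]
  end.

Section Scalars.
Variable R : realType.

(* [`|z|] would be an element of R[i] in the complex case; the modulus lives
   in R. *)
Definition modulus (k : scalar_kind) : scalar_field R k -> R :=
  match k return scalar_field R k -> R with
  | real_scalars => fun x : R => `|x|
  | complex_scalars => fun z : R[i] => ComplexField.Normc.normc z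
  end.

Definition scalar_measurable (k : scalar_kind) (D : set R) :
    (R -> scalar_field R k) -> Prop :=
  match k return (R -> scalar_field R k) -> Prop with
  | real_scalars => fun f : R -> R => measurable_fun D f
  | complex_scalars => fun f : R -> R[i] =>
      measurable_fun D (fun t => complex.Re (f t)) /\
      measurable_fun D (fun t => complex.Im (f t))
  end.

Definition scalar_integral (k : scalar_kind) (D : set R) :
    (R -> scalar_field R k) -> scalar_field R k :=
  match k return (R -> scalar_field R k) -> scalar_field R k with
  | real_scalars => fun f : R -> R => \int[lebesgue_measure]_(t in D) f t
  | complex_scalars => fun f : R -> R[i] =>
      Complex (\int[lebesgue_measure]_(t in D) complex.Re (f t))
              (\int[lebesgue_measure]_(t in D) complex.Im (f t))
  end.

End Scalars.

(* A function on [0, 1] is represented by a function on R whose values outside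
   [0, 1] are irrelevant, and an element of L_{w,p} by any representative of
   its class modulo equality almost everywhere on [0, 1]. *)
Definition ae_eq01 (R : realType) (K : Type) (f g : R -> K) : Prop :=
  f = g %[ae @lebesgue_measure R in `[0, 1]%classic].

Definition lorentz_weight (R : realType) (w : R -> R) : Prop :=
  (forall t, 0 < t < 1 -> 0 < w t) /\
  (forall s t, 0 < s -> s <= t -> t < 1 -> w t <= w s).

Section Lorentz.
Variables (R : realType) (k : scalar_kind).
Notation K := (scalar_field R k).
Notation mu := (@lebesgue_measure R).

(* Only used for 0 < t < 1, where the infimum is taken over a nonempty set
   bounded below by 0 when f is measurable. *)
Definition rearrangement (f : R -> K) (t : R) : R :=
  inf [set s | (mu (`[0%R, 1%R] `&` [set u | (s < modulus (f u))%R]) <= t%:E)%E].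

(* The integral is over ]0, 1[ because w is only defined there. *)
Definition lorentz_norm (w : R -> R) (p : R) (f : R -> K) : \bar R :=
  ((\int[mu]_(t in `]0%R, 1%R[) (w t * rearrangement f t `^ p)%R%:E) `^ (p^-1)%R)%E.

Definition lorentz_space (w : R -> R) (p : R) : set (R -> K) :=
  [set f | scalar_measurable `[0, 1] f /\ (lorentz_norm w p f < +oo)%E].

(* The last clause also makes Y stable under equality almost everywhere. *)
Definition closed_subspace (w : R -> R) (p : R) (Y : set (R -> K)) : Prop :=
  [/\ Y `<=` lorentz_space w p,
      Y (fun=> 0),
      forall (a : K) (f g : R -> K), Y f -> Y g -> Y (fun t => a * f t + g t)
    & forall f : R -> K, lorentz_space w p f ->
        (forall eps : R, 0 < eps -> exists2 y : R -> K, Y y &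
           (lorentz_norm w p (fun t => f t - y t)%R < eps%:E)%E) ->
        Y f].

Definition rich_subspace (w : R -> R) (p : R) (Y : set (R -> K)) : Prop :=
  closed_subspace w p Y /\
  forall (A : set R) (eps : R), measurable A -> A `<=` `[0, 1] -> 0 < eps ->
    exists y x : R -> K,
      [/\ Y y, lorentz_space w p x,
          ae_eq01 (fun t => x t ^+ 2) \1_A,
          scalar_integral `[0, 1] x = 0
        & (lorentz_norm w p (fun t => x t - y t)%R < eps%:E)%E].

(* An operator on L_{w,p} is given by its action on representatives; the
   second clause says that it acts on classes. *)
Definition bounded_operator (w : R -> R) (p : R)
    (P : (R -> K) -> (R -> K)) : Prop :=
  [/\ forall f, lorentz_space w p f -> lorentz_space w p (P f),
      forall f g, lorentz_space w p f -> lorentz_space w p g ->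
        ae_eq01 f g -> ae_eq01 (P f) (P g),
      forall (a : K) f g, lorentz_space w p f -> lorentz_space w p g ->
        ae_eq01 (P (fun t => a * f t + g t)) (fun t => a * P f t + P g t)
    & exists C : R, forall f, lorentz_space w p f ->
        (lorentz_norm w p (P f) <= C%:E * lorentz_norm w p f)%E].

Definition operator_norm (w : R -> R) (p : R)
    (P : (R -> K) -> (R -> K)) : \bar R :=
  ereal_sup [set lorentz_norm w p (P f) |
    f in [set f | lorentz_space w p f /\ (lorentz_norm w p f <= 1)%E]].

Definition is_projection (w : R -> R) (p : R)
    (P : (R -> K) -> (R -> K)) : Prop :=
  bounded_operator w p P /\
  forall f, lorentz_space w p f -> ae_eq01 (P (P f)) (P f).

Definition has_range (w : R -> R) (p : R)
    (P : (R -> K) -> (R -> K)) (Y : set (R -> K)) : Prop :=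
  forall g, lorentz_space w p g ->
    (Y g <-> exists2 f, lorentz_space w p f & ae_eq01 (P f) g).

Definition is_identity (w : R -> R) (p : R)
    (P : (R -> K) -> (R -> K)) : Prop :=
  forall f, lorentz_space w p f -> ae_eq01 (P f) f.

End Lorentz.

(* Main.v *)
Require Import Defs.
From mathcomp Require Import all_boot all_order all_algebra.
From mathcomp Require Import all_classical all_reals all_analysis measurable_realfun.
From mathcomp Require Import complex ring lra.

Import Order.TTheory GRing.Theory Num.Theory.
Import numFieldNormedType.Exports.
Local Open Scope classical_set_scope.
Local Open Scope ring_scope.

Set Implicit Arguments.
Unset Strict Implicit.
Unset Printing Implicit Defensive.

(* The complementary projection Q = Id - P is narrow.  Pick f <> 0 with P f = 0
   and approximate it by a step function F with steps a_i on cells A_i.  Applying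
   richness twice in each cell gives a quarter B_i of A_i such that the mean zero
   function H equal to 3 a_i on B_i and to -a_i on A_i \ B_i is close to some y
   in Y.  Then P (y - s f) = y, hence ||P|| is at least about ||H|| / ||H - s F||.
   For p > 2 and small s > 0, the p-th powers of the moduli (3 - s, 1 + s, 1 + s,
   1 + s) of H - s F on the quarters of a cell are majorized by kappa times those
   (3, 1, 1, 1) of H, with kappa < 1 depending only on p.  Writing the weight as a
   mixture of indicators of intervals ]0, c[, the p-th power of a Lorentz norm
   becomes a mixture of integrals of min(d, c), d being the distribution function
   of |f|^p; these are monotone for majorization, and min(., c) is subadditive,
   whence N (f + g) <= (1 + eta) N f + C_eta N g for N = ||.||^p, which absorbs
   the approximation errors. *)

(** * Layer cake formula and non-increasing rearrangements *)

Section Rearrangement.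
Variable R : realType.
Notation mu := (@lebesgue_measure R).

(** Richness only splits sets into halves, and a single halving gives no gain: subtracting s from
    the values 1 and -1 leads to the moduli 1 - s and 1 + s, and (1 - s)^p + (1 + s)^p >= 2 by
    convexity. Skewness is what produces a gain. If h equals n - 1 on an n-th part of a cell and -1
    on the rest, the derivative at s = 0 of the integral of |h - s|^p has the sign of (n - 1) - (n -
    1)^(p - 1), which is negative once n > 2 and p > 2. Halving twice gives n = 4, hence the values
    3 and -1. A comparison of integrals of p-th powers covers only a constant weight. Majorization
    is the form of it that holds for every weight at once, so that kappa, and the final constant
    with it, sees only p. The gain is available only for step functions, while the kernel element f
    and the element y of Y are arbitrary. Passing between them must therefore cost a factor
    arbitrarily close to 1 on the main term, with the large constant falling on an error that is
    made small afterwards. *)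

Definition nonincreasing01 (g : R -> R) : Prop :=
  forall s t, 0 < s -> s <= t -> t < 1 -> g t <= g s.

(** Tonelli's theorem on the region under the graph of [g]. The density [k] is there because the
    formula is used twice: for [w], with the p-th power of a rearrangement as density, and for that
    power, with density 1. Measurability in the level is part of the conclusion because these inner
    integrals are compared and added under an outer integral. *)
Lemma layer_cake (D : set R) (k : R -> \bar R) (g : R -> R) :
  measurable D -> measurable_fun D k -> measurable_fun D g ->
  (forall t, D t -> (0 <= k t)%E) -> (forall t, D t -> 0 <= g t) ->
  measurable_fun [set: R]
    (fun s => \int[mu]_(t in D `&` [set t | (s < g t)%R]) k t)%E /\
  (\int[mu]_(t in D) (k t * (g t)%:E) =
   \int[mu]_(s in `]0%R, +oo[) \int[mu]_(t in D `&` [set t | (s < g t)%R]) k t)%E.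
Proof.
move=> mD mk mg k0 g0.
pose g' := g \_ D; pose k' := k \_ D.
have mg' : measurable_fun [set: R] g' by exact: (measurable_restrictT _ mD).1 _.
have mk' : measurable_fun [set: R] k' by exact: (measurable_restrictT _ mD).1 _.
have k'0 t : (0 <= k' t)%E.
  by rewrite /k' patchE; case: ifPn => // /set_mem; exact: k0.
have g'0 t : 0 <= g' t.
  by rewrite /g' patchE; case: ifPn => // /set_mem; exact: g0.
pose F (z : R * R) : \bar R :=
  if (z.2 < g' z.1) && (0 < z.2) then k' z.1 else 0%E.
(* [F'] omits the condition that the level be positive: its section integrals give measurability on
   the whole line, while [F] gives the formula. *)
pose F' (z : R * R) : \bar R := if z.2 < g' z.1 then k' z.1 else 0%E.
have m2 : measurable_fun [set: R * R] (fun z : R * R => z.2).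
  exact: measurable_snd.
have mg1 : measurable_fun [set: R * R] (fun z : R * R => g' z.1).
  exact: (measurableT_comp mg' measurable_fst).
have mk1 : measurable_fun [set: R * R] (fun z : R * R => k' z.1).
  exact: (measurableT_comp mk' measurable_fst).
have mlt : measurable_fun [set: R * R] (fun z : R * R => z.2 < g' z.1).
  exact: measurable_fun_ltr.
have mF' : measurable_fun [set: R * R] F'.
  exact: (measurable_fun_ifT mlt mk1 (measurable_cst 0%E)).
have mF : measurable_fun [set: R * R] F.
  apply: measurable_fun_ifT => //; apply: measurable_and => //.
  by apply: measurable_fun_ltr.
have F'0 z : (0 <= F' z)%E by rewrite /F'; case: ifP.
have F0 z : (0 <= F z)%E by rewrite /F; case: ifP.
have GE s : (\int[mu]_(t in D `&` [set t | (s < g t)%R]) k t =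
    \int[mu]_t F' (t, s))%E.
  rewrite integral_mkcond; apply: eq_integral => t _; rewrite /F' /= /k' /g'.
  rewrite !patchE in_setI; case: (boolP (t \in D)) => tD /=; last by rewrite if_same.
  case: ifPn => [/set_mem/= -> //|]; rewrite notin_setE/= => /negP/negbTE -> //.
split.
  apply: (eq_measurable_fun (fubini_G mu F')); first by move=> s _; rewrite GE.
  exact: measurable_fun_fubini_tonelli_G.
rewrite integral_mkcond.
transitivity (\int[mu]_t \int[mu]_s F (t, s))%E.
  apply: eq_integral => t _.
  transitivity (k' t * (g' t)%:E)%E.
    by rewrite /k' /g' !patchE; case: ifP => // _; rewrite mule0.
  rewrite (_ : (fun s => F (t, s)) = (cst (k' t)) \_ `]0, g' t[); last first.
    apply/funext => s; rewrite patchE mem_setE in_itv/= /F/= andbC.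
    by case: (0 < s) => //=.
  rewrite -integral_mkcond integral_cst// /= lebesgue_measure_itv/= lte_fin.
  by case: ltgtP (g'0 t) => // [_|<-] _; rewrite ?oppr0 ?sube0 ?addr0.
rewrite fubini_tonelli// [RHS]integral_mkcond; apply: eq_integral => s _.
rewrite patchE mem_setE in_itv/= andbT; case: ifPn => s0.
  by rewrite GE; apply: eq_integral => t _; rewrite /F /F' /= s0 andbT.
by apply: integral0_eq => t _; rewrite /F/= (negbTE s0) andbF.
Qed.

Lemma nonincreasing01_measurable (g : R -> R) : nonincreasing01 g ->
  measurable_fun (`]0, 1[ : set R) g.
Proof.
move=> dg mD; apply: (measurability _ (RGenOInfty.measurableE R)) => //.
move=> /= _ [_ [a ->] <-]; apply: is_interval_measurable.
move=> x y /= [] xi gx [] yi gy z /andP[xz zy].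
move: xi yi gx gy; rewrite /= !in_itv/= !andbT => /andP[x0 x1] /andP[y0 y1] gx gy.
split; first by rewrite (lt_le_trans x0)// (le_lt_trans zy).
by apply: (lt_le_trans gy); apply: dg => //; exact: (lt_le_trans x0).
Qed.

(** Upper level sets of nonincreasing functions are initial segments of ]0, 1[, so two of them are
    always nested and the intersection is the smaller one. This is the origin of the minimum in
    [capped]. *)
Lemma measure_upper_levelI (g h : R -> R) (a b : R) :
  nonincreasing01 g -> nonincreasing01 h ->
  mu (`]0, 1[ `&` [set t | a < g t] `&` [set t | b < h t]) =
  Order.min (mu (`]0, 1[ `&` [set t | a < g t]))
            (mu (`]0, 1[ `&` [set t | b < h t])).
Proof.
move=> dg dh.
have mA (f : R -> R) c : nonincreasing01 f -> measurable (`]0, 1[ `&` [set t | c < f t]).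
  move=> df; rewrite (_ : [set t | _] = f @^-1` `]c, +oo[); last first.
    by apply/seteqP; split => t /=; rewrite in_itv/= andbT.
  by apply: nonincreasing01_measurable => //; exact: measurable_itv.
rewrite -setIA; set A := [set t | a < g t]; set B := [set t | b < h t].
have [AB|/existsNP[t /not_implyP[[t01 At] nBt]]] :=
  pselect (`]0, 1[ `&` A `<=` `]0, 1[ `&` B).
  rewrite min_l; last by apply: le_measure; rewrite ?inE//; exact: mA.
  by congr (mu _); rewrite setIA; apply/setIidPl; apply: subset_trans AB _; exact: subIsetr.
have BA : `]0, 1[ `&` B `<=` `]0, 1[ `&` A.
  move=> u [u01 Bu]; split => //; rewrite /A /=.
  move: (u01) (t01); rewrite /= !in_itv/= => /andP[u0 u1] /andP[t0 t1].
  apply: (lt_le_trans At); apply: dg => //; rewrite leNgt; apply/negP => tu.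
  by apply: nBt; split => //; apply: (lt_le_trans Bu); apply: dh => //; exact: ltW.
rewrite min_r; last by apply: le_measure; rewrite ?inE//; exact: mA.
by congr (mu _); rewrite setICA; apply/setIidPr; apply: subset_trans BA _; exact: subIsetr.
Qed.

End Rearrangement.

(** * Lorentz functionals as mixtures of capped distribution functions *)

Section CappedWeights.
Variable R : realType.
Notation mu := (@lebesgue_measure R).

(* The definitions of the theorem, for the modulus [phi] of a function. *)
Definition dist (phi : R -> R) (s : R) : \bar R :=
  mu (`[0, 1] `&` [set u | s < phi u]).

Definition rearr (phi : R -> R) (t : R) : R :=
  inf [set s | (dist phi s <= t%:E)%E].

(* The [p]-th power of the Lorentz norm. *)
Definition lnorm (w : R -> R) (p : R) (phi : R -> R) : \bar R :=
  (\int[mu]_(t in `]0%R, 1%R[) (w t * rearr phi t `^ p)%R%:E)%E.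

Definition nonneg_measurable01 (phi : R -> R) : Prop :=
  measurable_fun (`[0, 1] : set R) phi /\ forall u, 0 <= phi u.

Lemma measurable_level phi s : nonneg_measurable01 phi ->
  measurable (`[0, 1] `&` [set u | s < phi u] : set R).
Proof.
move=> [mphi _]; rewrite (_ : [set u | _] = phi @^-1` `]s, +oo[); last first.
  by apply/seteqP; split => t /=; rewrite in_itv/= andbT.
by apply: mphi => //; exact: measurable_itv.
Qed.

Lemma mu01 : mu (`[0, 1] : set R) = 1%E.
Proof. by rewrite lebesgue_measure_itv/= lte_fin ltr01 oppr0 adde0. Qed.

Lemma dist_ge0 phi s : (0 <= dist phi s)%E.
Proof. exact: measure_ge0. Qed.

Lemma dist_le1 phi s : nonneg_measurable01 phi -> (dist phi s <= 1)%E.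
Proof.
move=> mphi; rewrite -mu01; apply: le_measure; rewrite ?inE//.
exact: measurable_level.
Qed.

Lemma dist_fin_num phi s : nonneg_measurable01 phi -> dist phi s \is a fin_num.
Proof.
move=> mphi; rewrite ge0_fin_numE ?dist_ge0//.
by rewrite (le_lt_trans (dist_le1 _ mphi))// ltry.
Qed.

Lemma dist_le phi psi s s' : nonneg_measurable01 phi -> nonneg_measurable01 psi ->
  (forall u, 0 <= u <= 1 -> s' < psi u -> s < phi u) ->
  (dist psi s' <= dist phi s)%E.
Proof.
move=> mphi mpsi h; apply: le_measure; rewrite ?inE; [exact: measurable_level..|].
by move=> u [u01 su]; split => //; apply: h => //; move: u01; rewrite /= in_itv.
Qed.

Lemma dist_nonincreasing phi s s' : nonneg_measurable01 phi -> s <= s' ->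
  (dist phi s' <= dist phi s)%E.
Proof. by move=> mphi ss'; apply: dist_le => // u _; exact: le_lt_trans. Qed.

(** Continuity from above: [phi] is real-valued, so its upper level sets at the naturals shrink to
    the empty set. *)
Lemma dist_cvg0 phi (e : R) : nonneg_measurable01 phi -> 0 < e ->
  exists n : nat, (dist phi n%:R <= e%:E)%E.
Proof.
move=> mphi e0; pose F (n : nat) := `[0, 1] `&` [set u | n%:R < phi u].
have mF n : measurable (F n) by exact: measurable_level.
have : mu (F n) @[n --> \oo] --> mu (\bigcap_n F n).
  apply: nonincreasing_cvg_mu => //.
  - by rewrite -ge0_fin_numE ?measure_ge0//; exact: dist_fin_num.
  - exact: bigcapT_measurable.
  - move=> m n mn; apply/subsetPset => u [u01 /= nu]; split => //=.
    by apply: le_lt_trans nu; rewrite ler_nat.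
rewrite (_ : \bigcap_n F n = set0) ?measure0; last first.
  apply/seteqP; split => // u /(_ (Num.truncn (phi u)).+1 I) [_ /=].
  by rewrite ltNge ltW// truncnS_gt.
move=> /fine_cvgP [_ /cvgrPdist_le /(_ e e0) [N _ /(_ N (leqnn N))]] /=.
rewrite sub0r normrN ger0_norm ?fine_ge0 ?measure_ge0// => FN.
by exists N; rewrite -[dist _ _]fineK ?dist_fin_num// lee_fin.
Qed.

(** Continuity from below, along the levels s + 1/(n + 1), whose upper level sets exhaust the one at
    [s]. *)
Lemma dist_right_continuous phi s (e : \bar R) : nonneg_measurable01 phi ->
  (forall s', s < s' -> (dist phi s' <= e)%E) -> (dist phi s <= e)%E.
Proof.
move=> mphi h; pose F (n : nat) := `[0, 1] `&` [set u | s + n.+1%:R^-1 < phi u].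
have mF n : measurable (F n) by exact: measurable_level.
have : mu (F n) @[n --> \oo] --> mu (\bigcup_n F n).
  apply: nondecreasing_cvg_mu => //; first exact: bigcupT_measurable.
  move=> m n mn; apply/subsetPset => u [u01 /= nu]; split => //=.
  by apply: le_lt_trans nu; rewrite lerD2l lef_pV2 ?posrE// ler_nat.
rewrite (_ : \bigcup_n F n = `[0, 1] `&` [set u | s < phi u]); last first.
  apply/seteqP; split => [u [n _ [u01 /= nu]]|u [u01 /= su]].
    by split => //=; apply: lt_trans nu; rewrite ltrDl.
  exists (Num.truncn (phi u - s)^-1) => //; split => //=.
  rewrite addrC -ltrBrDr invf_plt ?posrE ?subr_gt0//; exact: truncnS_gt.
move=> cv; have := cvg_lim _ cv => /(_ (@ereal_hausdorff _)) E.
change (dist phi s) with (mu (`[0, 1] `&` [set u | s < phi u])); rewrite -[X in (X <= _)%E]E.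
apply: lime_le.
  apply: ereal_nondecreasing_is_cvgn => m n mn; apply: le_measure; rewrite ?inE; [exact: mF..|].
  move=> u [u01 /= nu]; split => //=.
  by apply: le_lt_trans nu; rewrite lerD2l lef_pV2 ?posrE// ler_nat.
by apply: nearW => n; apply: h; rewrite ltrDl.
Qed.

Lemma rearr_set_lbound phi t s : nonneg_measurable01 phi -> t < 1 ->
  (dist phi s <= t%:E)%E -> 0 <= s.
Proof.
move=> mphi t1; apply: contraTT; rewrite -!ltNge => s0.
rewrite (_ : dist phi s = 1%E) ?lte_fin// -mu01; congr (mu _).
by apply/setIidPl => u _ /=; apply: lt_le_trans s0 _; case: mphi.
Qed.

(** Right continuity of [dist] makes the infimum defining [rearr] attained, so strict inequalities
    transfer exactly in both directions. The bound [0 < t] makes the set nonempty and [t < 1] bounds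
    it below by 0. *)
Lemma lt_rearr phi t s : nonneg_measurable01 phi -> 0 < t < 1 ->
  (s < rearr phi t) = (t%:E < dist phi s)%E.
Proof.
move=> mphi /andP[t0 t1]; have [n dn] := dist_cvg0 mphi t0.
have hi : has_inf [set s | (dist phi s <= t%:E)%E].
  by split; [exists n%:R|exists 0 => r; exact: rearr_set_lbound].
apply/idP/idP; apply: contraTT; rewrite -!leNgt => h.
  by apply: ge_inf => //; case: hi.
apply: dist_right_continuous => // s' ss'.
have [r /= dr rs] := inf_lt hi.1 (le_lt_trans h ss').
by apply: le_trans dr; apply: dist_nonincreasing => //; exact: ltW.
Qed.

Lemma rearr_ge0 phi t : nonneg_measurable01 phi -> 0 < t < 1 -> 0 <= rearr phi t.
Proof.
move=> mphi /andP[t0 t1]; have [n dn] := dist_cvg0 mphi t0.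
by apply: lb_le_inf; [exists n%:R|move=> r; exact: rearr_set_lbound].
Qed.

Lemma rearr_nonincreasing phi : nonneg_measurable01 phi -> nonincreasing01 (rearr phi).
Proof.
move=> mphi s t s0 st t1; have t0 := lt_le_trans s0 st.
have s1 := le_lt_trans st t1.
rewrite leNgt lt_rearr ?t0//; apply/negP => st'.
have : rearr phi s < rearr phi s.
  by rewrite lt_rearr ?s0//; apply: le_lt_trans st'; rewrite lee_fin.
by rewrite ltxx.
Qed.
Lemma rearr_powR_nonincreasing phi p : nonneg_measurable01 phi -> 0 <= p ->
  nonincreasing01 (fun t => rearr phi t `^ p).
Proof.
move=> mphi p0 s t s0 st t1; have t0 := lt_le_trans s0 st.
have s1 := le_lt_trans st t1.
apply: ge0_ler_powR => //; rewrite ?nnegrE.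
- by rewrite rearr_ge0// t0.
- by rewrite rearr_ge0// s0.
- exact: rearr_nonincreasing.
Qed.

(** Equimeasurability of a function and its rearrangement: by [lt_rearr] the level set on the left
    is exactly ]0, d[, where d is the value of [dist] on the right. *)
Lemma measure_level_rearr phi p s : nonneg_measurable01 phi -> 0 < p -> 0 < s ->
  mu (`]0, 1[ `&` [set t | s < rearr phi t `^ p]) = dist phi (s `^ p^-1).
Proof.
move=> mphi p0 s0; have [d dE] : exists d, dist phi (s `^ p^-1) = d%:E.
  by exists (fine (dist phi (s `^ p^-1))); rewrite fineK ?dist_fin_num.
have d0 : 0 <= d by rewrite -lee_fin -dE dist_ge0.
have d1 : d <= 1 by rewrite -lee_fin -dE dist_le1.
rewrite (_ : _ `&` _ = `]0, d[%classic).
  rewrite lebesgue_measure_itv/= lte_fin dE.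
  by case: ltgtP d0 => // [|<-] _; rewrite ?oppr0 ?adde0.
apply/seteqP; split => t; rewrite /= !in_itv/=.
  move=> [/andP[t0 t1] st]; rewrite t0/= -lte_fin -dE -lt_rearr ?t0//.
  have := gt0_ltr_powR (r := p^-1); rewrite invr_gt0 => /(_ p0 s (rearr phi t `^ p)).
  rewrite !nnegrE ltW// powR_ge0 => /(_ isT isT st).
  by rewrite -powRrM mulfV ?gt_eqF// powRr1// rearr_ge0// t0.
move=> /andP[t0 td]; have t1 := lt_le_trans td d1; rewrite t0 t1; split => //.
have : s `^ p^-1 < rearr phi t by rewrite lt_rearr ?t0// dE lte_fin.
have := gt0_ltr_powR p0 (x := s `^ p^-1) (y := rearr phi t).
rewrite !nnegrE powR_ge0 rearr_ge0 ?t0// => /(_ isT isT) h /h.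
by rewrite -powRrM mulVf ?gt_eqF// powRr1 ?(ltW s0).
Qed.

(* [c |-> capped p phi c] is the Lorentz functional of the weight [\1_]0, c[];
   by the layer cake formula for [w] every Lorentz norm is a mixture of these. *)
Definition capped (p : R) (phi : R -> R) (c : \bar R) : \bar R :=
  (\int[mu]_(s in `]0%R, +oo[) mine (dist phi (s `^ p^-1)%R) c)%E.

Definition weight_level (w : R -> R) (y : R) : \bar R :=
  mu (`]0, 1[ `&` [set t | y < w t]).

Lemma lnorm_capped w p phi : lorentz_weight w -> 0 < p -> nonneg_measurable01 phi ->
  measurable_fun [set: R] (fun y => capped p phi (weight_level w y)) /\
  (lnorm w p phi =
    \int[mu]_(y in `]0%R, +oo[) capped p phi (weight_level w y))%E.
Proof.
move=> [w0 wd] p0 mphi; pose r t := rearr phi t `^ p.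
have mr : measurable_fun (`]0, 1[ : set R) r.
  exact: (nonincreasing01_measurable (rearr_powR_nonincreasing mphi (ltW p0))).
have mw : measurable_fun (`]0, 1[ : set R) w.
  exact: (nonincreasing01_measurable wd).
(* On the level set of [w] a second layer cake, now for [r], produces measures of intersections of
   two level sets; nestedness turns them into minima. *)
have inner y : (\int[mu]_(t in `]0%R, 1%R[ `&` [set t | (y < w t)%R]) (r t)%:E =
    capped p phi (weight_level w y))%E.
  set D := _ `&` _.
  have mD : measurable D.
    rewrite /D (_ : [set t | _] = w @^-1` `]y, +oo[); last first.
      by apply/seteqP; split => t /=; rewrite in_itv/= andbT.
    exact: (mw (measurable_itv _) _ (measurable_itv _)).
  have [||||_] := @layer_cake R D (cst 1%E) r mD.
  - exact: measurable_cst.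
  - by apply: measurable_funS mr => // t [].
  - by [].
  - by move=> t _; exact: powR_ge0.
  under eq_integral do rewrite mul1e.
  move=> ->; apply: eq_integral => s; rewrite inE/= in_itv/= andbT => s0.
  rewrite integral_cst; last first.
    rewrite (_ : [set t | _] = r @^-1` `]s, +oo[); last first.
      by apply/seteqP; split => t /=; rewrite in_itv/= andbT.
    apply: (measurable_funS (measurable_itv _) _ mr) => //; by move=> ? [].
  rewrite mul1e /D /=.
  rewrite (measure_upper_levelI y s wd (rearr_powR_nonincreasing mphi (ltW p0))).
  by rewrite minC (measure_level_rearr mphi p0 s0).
have [||||m E] := @layer_cake R `]0, 1[ (EFin \o r) w (measurable_itv _).
- exact/measurable_EFinP.
- by [].
- by move=> t _; rewrite lee_fin powR_ge0.
- by move=> t; rewrite /= in_itv/= => /w0/ltW.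
split.
  by apply: eq_measurable_fun m => y _; rewrite -inner.
transitivity (\int[mu]_(t in `]0%R, 1%R[) ((EFin \o r) t * (w t)%:E))%E.
  by apply: eq_integral => t _; rewrite /= -EFinM mulrC.
by rewrite E; apply: eq_integral => y _; rewrite -inner.
Qed.

Lemma capped_ge0 p phi c : (0 <= c)%E -> (0 <= capped p phi c)%E.
Proof.
by move=> c0; apply: integral_ge0 => s _; rewrite le_min dist_ge0.
Qed.

Lemma weight_level_bounds w y : lorentz_weight w ->
  exists2 c : R, 0 <= c <= 1 & weight_level w y = c%:E.
Proof.
move=> [_ wd].
have mA : measurable (`]0, 1[ `&` [set t | y < w t] : set R).
  rewrite (_ : [set t | _] = w @^-1` `]y, +oo[); last first.
    by apply/seteqP; split => t /=; rewrite in_itv/= andbT.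
  exact: (nonincreasing01_measurable wd (measurable_itv _) (measurable_itv _)).
have h0 : (0 <= weight_level w y)%E by exact: measure_ge0.
have h1 : (weight_level w y <= 1)%E.
  rewrite (_ : 1%E = mu (`]0, 1[ : set R)).
    by apply: le_measure; rewrite ?inE//; exact: measurable_itv.
  by rewrite lebesgue_measure_itv/= lte_fin ltr01 oppr0 adde0.
case: (weight_level w y) h0 h1 => [c| |] //; rewrite !lee_fin => c0 c1.
by exists c => //; rewrite c0.
Qed.

(* The comparison principle: inequalities between Lorentz norms that hold for
   the weights [\1_]0, c[] hold for all weights. *)
Lemma lnorm_le_comb w p phi psi chi (a b : R) : lorentz_weight w -> 0 < p ->
  nonneg_measurable01 phi -> nonneg_measurable01 psi ->
  nonneg_measurable01 chi -> 0 <= a -> 0 <= b ->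
  (forall c : R, 0 <= c <= 1 -> (capped p phi c%:E <=
     a%:E * capped p psi c%:E + b%:E * capped p chi c%:E)%E) ->
  (lnorm w p phi <= a%:E * lnorm w p psi + b%:E * lnorm w p chi)%E.
Proof.
move=> ww p0 mphi mpsi mchi a0 b0 h.
have [m1 ->] := lnorm_capped ww p0 mphi.
have [m2 ->] := lnorm_capped ww p0 mpsi.
have [m3 ->] := lnorm_capped ww p0 mchi.
have ge0 f y : (0 <= capped p f (weight_level w y))%E.
  by apply: capped_ge0; exact: measure_ge0.
have mI : measurable (`]0, +oo[ : set R) by exact: measurable_itv.
have mTS (f : R -> \bar R) : measurable_fun [set: R] f -> measurable_fun (`]0, +oo[ : set R) f.
  exact: measurable_funTS.
have {m1}m1 := mTS _ m1; have {m2}m2 := mTS _ m2; have {m3}m3 := mTS _ m3.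
have m2a := measurable_funeM a%:E m2; have m3b := measurable_funeM b%:E m3.
have pos (r : R) f y : 0 <= r -> (0 <= r%:E * capped p f (weight_level w y))%E.
  by move=> r0; apply: mule_ge0 => //; rewrite lee_fin.
have ge0' f y : `]0%R, +oo[%classic y -> (0 <= capped p f (weight_level w y))%E.
  by move=> _; exact: ge0.
rewrite -(ge0_integralZl mu mI m2 (ge0' psi) (k := a%:E))//.
rewrite -(ge0_integralZl mu mI m3 (ge0' chi) (k := b%:E))//.
rewrite -(ge0_integralD mu mI (fun y _ => pos a psi y a0) m2a (fun y _ => pos b chi y b0) m3b).
apply: (ge0_le_integral mu mI (ge0' phi) m1 (emeasurable_funD m2a m3b)).
by move=> y _; have [c c01 ->] := weight_level_bounds y ww; exact: h.
Qed.

Lemma lnorm_le_scale w p phi psi (a : R) : lorentz_weight w -> 0 < p ->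
  nonneg_measurable01 phi -> nonneg_measurable01 psi -> 0 <= a ->
  (forall c : R, 0 <= c <= 1 ->
     (capped p phi c%:E <= a%:E * capped p psi c%:E)%E) ->
  (lnorm w p phi <= a%:E * lnorm w p psi)%E.
Proof.
move=> ww p0 mphi mpsi a0 h.
have := @lnorm_le_comb w p phi psi psi a 0 ww p0 mphi mpsi mpsi a0 (lexx _).
by rewrite mul0e adde0; apply => c c01; rewrite mul0e adde0; exact: h.
Qed.

Lemma capped_measurable p phi (c : R) : nonneg_measurable01 phi -> 0 < p ->
  measurable_fun (`]0, +oo[ : set R) (fun s => mine (dist phi (s `^ p^-1)) c%:E).
Proof.
move=> mphi p0.
have md : measurable_fun [set: R] (fun s : R => fine (dist phi s)).
  apply: nonincreasing_measurable => // s t st.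
  by apply: fine_le; rewrite ?dist_fin_num//; exact: dist_nonincreasing.
suff : measurable_fun (`]0, +oo[ : set R)
    (fun s => mine (fine (dist phi (s `^ p^-1)))%:E c%:E).
  by apply: eq_measurable_fun => s _; rewrite fineK ?dist_fin_num.
apply: measurable_funTS; apply: measurable_mine; last exact: measurable_cst.
apply/measurable_EFinP; exact: (measurableT_comp md (measurable_powR _)).
Qed.

Lemma capped_le_comb p phi psi chi (a b : R) (c : R) : 0 < p ->
  nonneg_measurable01 phi -> nonneg_measurable01 psi ->
  nonneg_measurable01 chi -> 0 <= a -> 0 <= b -> 0 <= c ->
  (forall s, 0 <= s -> (mine (dist phi s) c%:E <=
     a%:E * mine (dist psi s) c%:E + b%:E * mine (dist chi s) c%:E)%E) ->
  (capped p phi c%:E <= a%:E * capped p psi c%:E + b%:E * capped p chi c%:E)%E.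
Proof.
move=> p0 mphi mpsi mchi a0 b0 c0 h.
have ge0 f s : (0 <= mine (dist f s) c%:E)%E by rewrite le_min dist_ge0.
have mI : measurable (`]0, +oo[ : set R) by exact: measurable_itv.
rewrite -!ge0_integralZl//; try exact: capped_measurable.
rewrite -ge0_integralD//; try (by move=> y _; rewrite mule_ge0// lee_fin);
  try by apply: measurable_funeM; exact: capped_measurable.
apply: ge0_le_integral => //; first exact: capped_measurable.
  apply: emeasurable_funD; apply: measurable_funeM; exact: capped_measurable.
by move=> y _; apply: h; exact: powR_ge0.
Qed.
End CappedWeights.

(** * Monotonicity, homogeneity, quasi-triangle inequality and majorization for the Lorentz
    functional *)

Section LorentzFunctional.
Variable R : realType.
Notation mu := (@lebesgue_measure R).
Implicit Types (phi psi chi : R -> R) (w : R -> R) (p : R).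

Lemma nonneg_measurable01_cst (c : R) : 0 <= c -> nonneg_measurable01 (fun=> c).
Proof. by move=> c0; split => //; exact: measurable_cst. Qed.

Lemma nonneg_measurable01_scale (c : R) phi : 0 <= c ->
  nonneg_measurable01 phi -> nonneg_measurable01 (fun t => c * phi t).
Proof.
move=> c0 [mphi phi0]; split; last by move=> u; rewrite mulr_ge0.
by apply: measurable_funM => //; exact: measurable_cst.
Qed.

Lemma ae_le_dist phi psi s : nonneg_measurable01 phi -> nonneg_measurable01 psi ->
  {ae mu, forall u, `[0, 1]%classic u -> phi u <= psi u} ->
  (dist phi s <= dist psi s)%E.
Proof.
move=> mphi mpsi [N [mN N0 hN]].
have -> : dist psi s = (dist psi s + mu N)%E by rewrite N0 adde0.
apply: le_trans (measureU2 mu (measurable_level s mpsi) mN).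
apply: le_measure; rewrite ?inE; first exact: measurable_level.
  by apply: measurableU => //; exact: measurable_level.
move=> u [u01 /= su]; have [le|nle] := leP (phi u) (psi u).
  by left; split => //=; exact: lt_le_trans le.
by right; apply: hN => /= /(_ u01); rewrite leNgt nle.
Qed.

Lemma lnorm_le_dist w p phi psi : lorentz_weight w -> 0 < p ->
  nonneg_measurable01 phi -> nonneg_measurable01 psi ->
  (forall s, 0 <= s -> (dist phi s <= dist psi s)%E) ->
  (lnorm w p phi <= lnorm w p psi)%E.
Proof.
move=> ww p0 mphi mpsi h.
have := @lnorm_le_comb R w p phi psi psi 1 0 ww p0 mphi mpsi mpsi ler01 (lexx _).
rewrite mul0e adde0 mul1e; apply => c /andP[c0 c1].
apply: capped_le_comb => // s s0.
by rewrite mul0e adde0 mul1e le_min2// h.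
Qed.

Lemma ae_le_lnorm w p phi psi : lorentz_weight w -> 0 < p ->
  nonneg_measurable01 phi -> nonneg_measurable01 psi ->
  {ae mu, forall u, `[0, 1]%classic u -> phi u <= psi u} ->
  (lnorm w p phi <= lnorm w p psi)%E.
Proof.
by move=> ww p0 mphi mpsi h; apply: lnorm_le_dist => // s _; exact: ae_le_dist.
Qed.

Lemma lnorm_ge0 w p phi : lorentz_weight w -> (0 <= lnorm w p phi)%E.
Proof.
move=> [w0 _]; apply: integral_ge0 => t; rewrite /= in_itv/= => t01.
by rewrite lee_fin mulr_ge0 ?powR_ge0// ltW// w0.
Qed.

Lemma dist_scale (c : R) phi s : 0 < c ->
  dist (fun t => c * phi t) s = dist phi (s / c).
Proof.
move=> c0; congr (mu (_ `&` _)); apply/seteqP; split => u /=;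
by rewrite ltr_pdivrMr// mulrC.
Qed.

Lemma rearr_scale (c : R) phi t : 0 < c -> nonneg_measurable01 phi -> 0 < t < 1 ->
  rearr (fun t => c * phi t) t = c * rearr phi t.
Proof.
move=> c0 mphi t01.
have h s : (s < rearr (fun t => c * phi t) t) = (s < c * rearr phi t).
  rewrite lt_rearr//; last by apply: nonneg_measurable01_scale => //; exact: ltW.
  by rewrite dist_scale// -lt_rearr// ltr_pdivrMr// mulrC.
apply/eqP; rewrite eq_le; apply/andP; split; rewrite leNgt.
  by rewrite h ltxx.
by rewrite -h ltxx.
Qed.

Lemma weight_measurable w : lorentz_weight w -> measurable_fun (`]0, 1[ : set R) w.
Proof. by case=> _; exact: nonincreasing01_measurable. Qed.

Lemma rearr_powR_measurable p phi : 0 < p -> nonneg_measurable01 phi ->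
  measurable_fun (`]0, 1[ : set R) (fun t => rearr phi t `^ p).
Proof.
move=> p0 mphi; apply: nonincreasing01_measurable.
exact: (rearr_powR_nonincreasing mphi (ltW p0)).
Qed.

Lemma lnorm_scale w p (c : R) phi : lorentz_weight w -> 0 < p -> 0 < c ->
  nonneg_measurable01 phi ->
  (lnorm w p (fun t => c * phi t)%R = (c `^ p)%:E * lnorm w p phi)%E.
Proof.
move=> ww p0 c0 mphi; rewrite /lnorm -ge0_integralZl//.
- apply: eq_integral => t; rewrite inE/= in_itv/= => t01.
  rewrite -EFinM rearr_scale// powRM ?rearr_ge0 ?(ltW c0)//; congr EFin.
  by rewrite mulrCA.
- apply/measurable_EFinP; apply: measurable_funM.
    exact: weight_measurable.
  exact: rearr_powR_measurable.
- move=> t; rewrite /= in_itv/= => t01.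
  by rewrite lee_fin mulr_ge0 ?powR_ge0// ltW//; case: ww => + _; apply.
- by rewrite lee_fin powR_ge0.
Qed.

Lemma lnorm_le_add w p phi psi chi : lorentz_weight w -> 0 < p ->
  nonneg_measurable01 phi -> nonneg_measurable01 psi -> nonneg_measurable01 chi ->
  (forall c s : R, 0 <= c -> 0 <= s -> (mine (dist chi s) c%:E <=
     mine (dist phi s) c%:E + mine (dist psi s) c%:E)%E) ->
  (lnorm w p chi <= lnorm w p phi + lnorm w p psi)%E.
Proof.
move=> ww p0 mphi mpsi mchi h.
have H c : 0 <= c <= 1 -> (capped p chi c%:E <=
    1%:E * capped p phi c%:E + 1%:E * capped p psi c%:E)%E.
  case/andP=> c0 c1; apply: capped_le_comb => // s s0.
  by rewrite !mul1e; exact: h.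
suff : (lnorm w p chi <= 1%:E * lnorm w p phi + 1%:E * lnorm w p psi)%E.
  by move: (lnorm w p chi) (lnorm w p phi) (lnorm w p psi) => x y z; rewrite !mul1e.
by apply: lnorm_le_comb.
Qed.

(** If chi > s, then a phi > s or b psi > s, since otherwise chi <= s/a + s/b <= s. Hence the
    distribution functions satisfy a union bound, which survives capping. Taking [a] close to 1 and
    [b] conjugate to it keeps the cost of the main term close to 1. *)
Lemma lnorm_quasi_triangle w p (a b : R) phi psi chi : lorentz_weight w ->
  0 < p -> 0 < a -> 0 < b -> a^-1 + b^-1 <= 1 ->
  nonneg_measurable01 phi -> nonneg_measurable01 psi -> nonneg_measurable01 chi ->
  (forall u, 0 <= u <= 1 -> chi u <= phi u + psi u) ->
  (lnorm w p chi <= (a `^ p)%:E * lnorm w p phi + (b `^ p)%:E * lnorm w p psi)%E.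
Proof.
move=> ww p0 a0 b0 ab mphi mpsi mchi h.
have mphi' := nonneg_measurable01_scale (ltW a0) mphi.
have mpsi' := nonneg_measurable01_scale (ltW b0) mpsi.
rewrite -(lnorm_scale ww p0 a0 mphi) -(lnorm_scale ww p0 b0 mpsi).
apply: lnorm_le_add => // c s c0 s0.
set x := dist (fun t => a * _) s; set y := dist (fun t => b * _) s.
have hd : (dist chi s <= x + y)%E.
  apply: le_trans (measureU2 mu (measurable_level s mphi') (measurable_level s mpsi')).
  apply: le_measure; rewrite ?inE; first exact: measurable_level.
    by apply: measurableU; exact: measurable_level.
  move=> u [u01 /= su].
  suff /orP[au|bu] : (s < a * phi u) || (s < b * psi u).
  - by left.
  - by right.
  have {}h : chi u <= phi u + psi u by apply: h; move: u01; rewrite /= in_itv.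
  rewrite -implyNb -leNgt; apply/implyP => au.
  rewrite ltNge; apply/negP => bu; move: su; apply/negP; rewrite -leNgt.
  apply: (le_trans h); rewrite mulrC -ler_pdivlMr// in au.
  rewrite mulrC -ler_pdivlMr// in bu.
  by apply: (le_trans (lerD au bu)); rewrite -mulrDr ler_piMr.
have x0 : (0 <= x)%E by exact: dist_ge0.
have y0 : (0 <= y)%E by exact: dist_ge0.
(* The union bound matters only when neither term is capped; otherwise the right-hand side already
   reaches [c]. *)
have [xc|cx] := leP x c%:E; have [yc|cy] := leP y c%:E.
- by apply: le_trans hd; rewrite ge_min lexx.
- by rewrite ge_min leeDr ?orbT.
- by rewrite ge_min leeDl ?orbT.
- by rewrite ge_min leeDl ?lee_fin// orbT.
Qed.

Lemma dist_eq0_lnorm w p phi : lorentz_weight w -> 0 < p -> nonneg_measurable01 phi ->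
  dist phi 0 = 0%E -> lnorm w p phi = 0%E.
Proof.
move=> ww p0 mphi d0; apply/eqP; rewrite eq_le lnorm_ge0// andbT.
have := lnorm_le_scale (a := 0) ww p0 mphi mphi (lexx _).
rewrite mul0e; apply => c /andP[c0 c1]; rewrite mul0e.
have := capped_le_comb p0 mphi mphi mphi (lexx 0) (lexx 0) c0.
rewrite !mul0e !adde0; apply => s s0; rewrite !mul0e adde0 ge_min -d0.
by rewrite dist_nonincreasing.
Qed.

Lemma dist_gt0_level phi : nonneg_measurable01 phi -> dist phi 0 <> 0%E ->
  exists2 e : R, 0 < e & (0 < dist phi e)%E.
Proof.
move=> mphi d0; apply: contrapT => /forall2NP h; apply: d0.
apply/eqP; rewrite eq_le dist_ge0 andbT.
apply: dist_right_continuous => // s s0.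
by have [//|/negP] := h s; rewrite -leNgt.
Qed.

Lemma dist0_ae phi : nonneg_measurable01 phi -> dist phi 0 = 0%E ->
  {ae mu, forall u, `[0, 1]%classic u -> phi u = 0}.
Proof.
move=> mphi d0; exists (`[0, 1] `&` [set u | 0 < phi u]); split => //.
  exact: measurable_level.
move=> u /= /not_implyP[u01 /eqP pu]; split => //=.
by rewrite lt_neqAle eq_sym pu/=; case: mphi.
Qed.

Lemma lnorm_gt0 w p phi : lorentz_weight w -> 0 < p -> nonneg_measurable01 phi ->
  dist phi 0 <> 0%E -> (0 < lnorm w p phi)%E.
Proof.
move=> ww p0 mphi /(dist_gt0_level mphi)[e e0 de].
have [m dE] : exists m, dist phi e = m%:E.
  by exists (fine (dist phi e)); rewrite fineK ?dist_fin_num.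
have m0 : 0 < m by move: de; rewrite dE.
have m1 : m <= 1 by rewrite -lee_fin -dE dist_le1.
(* Half of [m], because [m] may be 1 and [w] is known to be positive only inside ]0, 1[. On ]0, m/2[
   the weight is at least its value at m/2 and the rearrangement exceeds [e]. *)
have hm : 0 < m / 2 < 1 by apply/andP; split; lra.
have wm : 0 < w (m / 2) by case: ww => + _; apply.
have c0 : 0 < w (m / 2) * e `^ p by rewrite mulr_gt0// powR_gt0.
apply: (@lt_le_trans _ _ (\int[mu]_(t in `]0%R, (m / 2)%R[) (w (m / 2) * e `^ p)%:E)%E).
  rewrite integral_cst//= lebesgue_measure_itv/= lte_fin.
  case/andP: (hm) => -> _.
  by rewrite oppr0 adde0 -EFinM lte_fin mulr_gt0//; case/andP: hm.
have sub : `]0, (m / 2)[ `<=` (`]0, 1[ : set R).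
  move=> t; rewrite /= !in_itv/= => /andP[t0 tm]; rewrite t0/=.
  by apply: (lt_trans tm); case/andP: hm.
have mwr : measurable_fun (`]0, 1[ : set R) (fun t => w t * rearr phi t `^ p).
  by apply: measurable_funM; [exact: weight_measurable|exact: rearr_powR_measurable].
have wr0 t : 0 < t < 1 -> 0 <= w t * rearr phi t `^ p.
  by move=> t01; rewrite mulr_ge0 ?powR_ge0// ltW//; case: ww => + _; apply.
apply: (@le_trans _ _ (\int[mu]_(t in `]0%R, (m / 2)%R[) (w t * rearr phi t `^ p)%:E)%E).
  apply: ge0_le_integral => //.
  - by move=> t _; rewrite lee_fin ltW.
  - apply/measurable_EFinP; exact: (measurable_funS (measurable_itv _) sub mwr).
  - move=> t tm; have := sub t tm; move: tm; rewrite /= !in_itv/= => /andP[t0 tm] t01.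
    have t1 : t < 1 by case/andP: t01.
    rewrite lee_fin ler_pM ?powR_ge0 ?(ltW wm)//.
      by case: ww => _; apply => //; [exact: ltW|case/andP: hm].
    apply: ge0_ler_powR; rewrite ?nnegrE ?rearr_ge0 ?(ltW p0) ?(ltW e0)//.
    by rewrite ltW// lt_rearr// dE lte_fin (lt_le_trans tm)//; lra.
by apply: ge0_subset_integral => //; exact/measurable_EFinP.
Qed.

(** [lorentz_weight] does not bound the integral of [w]; a single nonzero function of finite norm
    does. It is at least a multiple of 1 on a set of some measure m > 0, and m min(1, c) <= min(m,
    c) for c <= 1. *)
Lemma lnorm1_lty w p phi : lorentz_weight w -> 0 < p -> nonneg_measurable01 phi ->
  dist phi 0 <> 0%E -> (lnorm w p phi < +oo)%E -> (lnorm w p (fun=> 1%R) < +oo)%E.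
Proof.
move=> ww p0 mphi /(dist_gt0_level mphi)[e e0 de] fin.
have [m dE] : exists m, dist phi e = m%:E.
  by exists (fine (dist phi e)); rewrite fineK ?dist_fin_num.
have m0 : 0 < m by move: de; rewrite dE.
have m1 : m <= 1 by rewrite -lee_fin -dE dist_le1.
have e'0 : 0 < e^-1 by rewrite invr_gt0.
have mphi' := nonneg_measurable01_scale (ltW e'0) mphi.
have mone := nonneg_measurable01_cst (@ler01 R).
have m'0 : 0 <= m^-1 by rewrite invr_ge0 ltW.
have : (lnorm w p (fun=> 1%R) <= (m^-1)%:E * lnorm w p (fun t => e^-1 * phi t)%R)%E.
  apply: lnorm_le_scale => // c /andP[c0 c1].
  have := capped_le_comb p0 mone mphi' mphi' m'0 (lexx _) c0.
  rewrite mul0e adde0; apply => s s0; rewrite mul0e adde0.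
  have [s1|s1] := ltP s 1; last first.
    rewrite (_ : dist _ _ = 0%E).
      by rewrite min_l ?lee_fin// mule_ge0// le_min dist_ge0.
    rewrite /dist (_ : _ `&` _ = set0) ?measure0//.
    by apply/seteqP; split => // u [_ /=]; rewrite ltNge s1.
  apply: (@le_trans _ _ c%:E); first by rewrite ge_min lexx orbT.
  have dm : (m%:E <= dist (fun t => e^-1 * phi t)%R s)%E.
    rewrite dist_scale// -dE dist_nonincreasing//.
    by rewrite invrK ler_piMl// ltW.
  rewrite -(@lee_pmul2l _ m%:E)// muleA -(EFinM m m^-1) mulfV ?gt_eqF// mul1e.
  rewrite le_min -EFinM lee_fin ler_piMl// andbT.
  by apply: le_trans dm; rewrite lee_fin ler_piMr// ltW.
move=> /le_lt_trans; apply; rewrite lnorm_scale// lte_mul_pinfty//.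
rewrite lte_mul_pinfty// ?lee_fin ?powR_ge0//.
Qed.

(** Dominated convergence, with the integrand of [phi] as dominating function: for fixed t the
    rearrangement of the tail vanishes at t as soon as [dist phi n%:R] is at most t. *)
Lemma lnorm_tail w p phi (e : R) : lorentz_weight w -> 0 < p -> nonneg_measurable01 phi ->
  (lnorm w p phi < +oo)%E -> 0 < e ->
  exists n : nat,
    (lnorm w p (fun u => if (n%:R < phi u)%R then phi u else 0%R) < e%:E)%E.
Proof.
move=> ww p0 mphi fin e0.
pose F (n : nat) u := if n%:R < phi u then phi u else 0.
have mF n : nonneg_measurable01 (F n).
  case: mphi => mphi phi0; split; last by move=> u; rewrite /F; case: ifP.
  apply: measurable_fun_if => //.
  - by apply: measurable_fun_ltr => //; exact: measurable_cst.
  - by apply: measurable_funS mphi => // u [].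
have mwr (f : R -> R) : nonneg_measurable01 f ->
    measurable_fun (`]0, 1[ : set R) (fun t => (w t * rearr f t `^ p)%:E).
  move=> mf; apply/measurable_EFinP; apply: measurable_funM.
    exact: weight_measurable.
  exact: rearr_powR_measurable.
have wr0 (f : R -> R) t : 0 < t < 1 -> 0 <= w t * rearr f t `^ p.
  by move=> t01; rewrite mulr_ge0 ?powR_ge0// ltW//; case: ww => + _; apply.
have [|||||_ _ cv] := @dominated_convergence _ _ R mu `]0, 1[ (measurable_itv _)
  (fun n t => (w t * rearr (F n) t `^ p)%:E) (cst 0%E)
  (fun t => (w t * rearr phi t `^ p)%:E).
- by move=> n; exact: mwr.
- exact: measurable_cst.
- apply/aeW => t; rewrite /= in_itv/= => t01.
  have t0 : 0 < t by case/andP: t01.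
  have [N dN] := dist_cvg0 mphi t0.
  apply: cvg_near_cst; exists N => // n /= Nn; congr EFin.
  suff -> : rearr (F n) t = 0 by rewrite powR0 ?gt_eqF// mulr0.
  apply/eqP; rewrite eq_le rearr_ge0// andbT leNgt lt_rearr// -leNgt.
  apply: le_trans dN; apply: dist_le => // u _; rewrite /F; case: ifP.
    by move=> nu _; apply: le_lt_trans nu; rewrite ler_nat.
  by rewrite ltxx.
- apply/integrableP; split; first exact: mwr.
  move: fin; congr (_ < _)%E; apply: eq_integral => t.
  by rewrite inE/= in_itv/= => t01; rewrite ger0_norm// wr0.
- apply/aeW => t n; rewrite /= in_itv/= => t01.
  rewrite lee_fin ger0_norm; last exact: wr0.
  apply: ler_wpM2l.
    by rewrite ltW//; case: ww => + _; apply.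
  apply: ge0_ler_powR; rewrite ?nnegrE ?rearr_ge0 ?(ltW p0)//.
  rewrite leNgt lt_rearr// -leNgt.
  apply: (@le_trans _ _ (dist phi (rearr phi t))).
    apply: dist_le => // u _; rewrite /F; case: ifP => // _.
    by rewrite ltNge rearr_ge0.
  by rewrite leNgt -lt_rearr// ltxx.
have {}cv : (lnorm w p (F n) @[n --> \oo] --> 0)%E by move: cv; rewrite integral0.
move/fine_cvgP: cv => [[N1 _ f1] /cvgrPdist_lt /(_ e e0)[N2 _ f2]].
exists (maxn N1 N2); have := f2 (maxn N1 N2) (leq_maxr _ _).
have {}f1 := f1 (maxn N1 N2) (leq_maxl _ _).
rewrite /= sub0r normrN ger0_norm ?fine_ge0 ?lnorm_ge0// => h.
by rewrite -(fineK f1) lte_fin.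
Qed.

(* The Hardy-Littlewood-Polya principle, split at the level [l] where the
   distribution function of [psi] crosses [c]. *)
Lemma capped_majorization p phi psi (c : R) : 0 < p -> 0 <= c ->
  nonneg_measurable01 phi -> nonneg_measurable01 psi ->
  (forall l : R, 0 <= l ->
    (\int[mu]_(s in `]l, +oo[) dist phi (s `^ p^-1)%R <=
     \int[mu]_(s in `]l, +oo[) dist psi (s `^ p^-1)%R)%E) ->
  (capped p phi c%:E <= capped p psi c%:E)%E.
Proof.
(* For c = 0 the crossing level may not exist: the distribution function of an unbounded [psi] never
   reaches 0. *)
move=> p0; rewrite le_eqVlt => /predU1P[<-|c0] mphi mpsi h.
  have -> : capped p phi 0%:E = 0%E.
    by apply: integral0_eq => s _; rewrite min_r ?dist_ge0.
  exact: capped_ge0.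
pose g (f : R -> R) s := dist f (s `^ p^-1).
have pV0 : 0 < p^-1 by rewrite invr_gt0.
have gle f : nonneg_measurable01 f -> forall s t, 0 <= s -> s <= t -> (g f t <= g f s)%E.
  move=> mf s t s0 st; apply: dist_nonincreasing => //.
  by apply: ge0_ler_powR; rewrite ?nnegrE ?(ltW pV0)// (le_trans s0).
pose S := [set s | 0 <= s /\ (g psi s <= c%:E)%E].
have Sinf : has_inf S.
  split; last by exists 0 => s [].
  have [n dn] := dist_cvg0 mpsi c0.
  exists (n%:R `^ p); split; first exact: powR_ge0.
  by rewrite /g -powRrM mulfV ?gt_eqF// powRr1.
pose l := inf S.
have l0 : 0 <= l by apply: lb_le_inf => [|s []//]; case: Sinf.
have above s : l < s -> (g psi s <= c%:E)%E.
  move=> ls; have [r [r0 gr] rs] := inf_lt Sinf.1 ls.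
  by apply: le_trans gr; apply: gle => //; exact: ltW.
have below s : 0 <= s -> s < l -> (c%:E <= g psi s)%E.
  move=> s0 sl; rewrite leNgt; apply/negP => /ltW gs.
  by move: sl; rewrite ltNge => /negP; apply; apply: ge_inf; [case: Sinf|].
have ge0 f s : (0 <= mine (g f s) c%:E)%E by rewrite le_min dist_ge0 lee_fin ltW.
have mm f : nonneg_measurable01 f ->
    measurable_fun (`]0, +oo[ : set R) (fun s => mine (g f s) c%:E).
  by move=> mf; exact: capped_measurable.
have mg f : nonneg_measurable01 f -> measurable_fun (`]0, +oo[ : set R) (g f).
  (* A cap at 1 changes nothing, since [dist] is at most 1. *)
  move=> mf; have mmf := capped_measurable 1 mf p0.
  apply: eq_measurable_fun mmf => s _.
  by rewrite min_l// dist_le1.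
have subl : `]l, +oo[ `<=` (`]0, +oo[ : set R).
  by move=> s; rewrite /= !in_itv/= !andbT; exact: le_lt_trans.
have sub0 : `]0, l] `<=` (`]0, +oo[ : set R).
  by move=> s; rewrite /= !in_itv/= andbT => /andP[].
have sub0' : `]0, l[ `<=` (`]0, +oo[ : set R).
  by move=> s; rewrite /= !in_itv/= andbT => /andP[].
have mI (i : interval R) : measurable [set` i] by exact: measurable_itv.
have mul0 b : mu [set` Interval (BRight 0) (BSide b l)] = l%:E.
  rewrite lebesgue_measure_itv/= lte_fin.
  by case: ltgtP l0 => // [_|<-] _; rewrite ?oppr0 ?adde0.
(* For [phi], the integrand is bounded by the cap up to [l] and by the uncapped function beyond it.
   For [psi] both bounds are attained, so the same sum is a lower bound there. *)
apply: (@le_trans _ _ (c%:E * l%:E + \int[mu]_(s in `]l, +oo[) g psi s)%E).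
  have -> : capped p phi c%:E = (\int[mu]_(s in `]0%R, l]) mine (g phi s) c%:E +
      \int[mu]_(s in `]l, +oo[) mine (g phi s) c%:E)%E.
    rewrite -ge0_integral_setU//.
    - by rewrite -itv_bndbnd_setU//= ?bnd_simp.
    - rewrite -itv_bndbnd_setU//= ?bnd_simp//; exact: mm.
    - rewrite disj_set2E; apply/eqP/seteqP; split => // s [] /=.
      by rewrite !in_itv/= andbT => /andP[_ sl]; rewrite ltNge sl.
  apply: leeD.
    rewrite -(mul0 false) -integral_cst//; apply: ge0_le_integral => //.
    - by apply: (measurable_funS (mI _) sub0); exact: mm.
    - by move=> s _; rewrite ge_min lexx orbT.
  apply: le_trans (h l l0); apply: ge0_le_integral => //.
  - by apply: (measurable_funS (mI _) subl); exact: mm.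
  - by apply: (measurable_funS (mI _) subl); exact: mg.
  - by move=> s _; rewrite ge_min lexx.
(* The point [l] itself is left out, since [below] and [above] say nothing about it; it has measure
   zero. *)
apply: (@le_trans _ _ (\int[mu]_(s in `]0%R, l[ `|` `]l, +oo[) mine (g psi s) c%:E)%E); last first.
  apply: ge0_subset_integral => //; first exact: measurableU.
    exact: mm.
  by move=> s [/sub0'|/subl].
have mU : measurable_fun (`]0, l[ `|` `]l, +oo[ : set R) (fun s => mine (g psi s) c%:E).
  apply: measurable_funS (mm _ mpsi) => //.
  by move=> s [/sub0'|/subl].
rewrite ge0_integral_setU//; last first.
  rewrite disj_set2E; apply/eqP/seteqP; split => // s [] /=.
  by rewrite !in_itv/= andbT => /andP[_ sl]; rewrite ltNge (ltW sl).
apply: leeD.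
  rewrite -(mul0 true) -integral_cst//; apply: ge0_le_integral => //.
  - by move=> s _; rewrite lee_fin ltW.
  - by apply: (measurable_funS (mI _) sub0'); exact: mm.
  - move=> s; rewrite /= in_itv/= => /andP[s0 sl].
    by rewrite le_min lexx andbT below// ltW.
apply: ge0_le_integral => //.
- by apply: (measurable_funS (mI _) subl); exact: mg.
- by apply: (measurable_funS (mI _) subl); exact: mm.
- by move=> s; rewrite /= in_itv/= andbT => ls; rewrite le_min lexx/= above.
Qed.
End LorentzFunctional.

(** * Majorization of step functions *)

Section Step.
Variable R : realType.
Notation mu := (@lebesgue_measure R).

Definition step_on (I : finType) (C : I -> set R) (v : I -> R) (phi : R -> R) :=
  (forall i u, C i u -> phi u = v i) /\
  (forall u, 0 <= u <= 1 -> (forall i, ~ C i u) -> phi u = 0).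

Definition cells01 (I : finType) (C : I -> set R) :=
  [/\ forall i, measurable (C i), forall i, C i `<=` `[0, 1] &
      forall i j u, C i u -> C j u -> i = j].

Lemma powR_inv_lt (p s v : R) : 0 < p -> 0 <= s -> 0 <= v ->
  (s `^ p^-1 < v) = (s < v `^ p).
Proof.
move=> p0 s0 v0; have pV0 : 0 < p^-1 by rewrite invr_gt0.
have sE : (s `^ p^-1) `^ p = s by rewrite -powRrM mulVf ?gt_eqF// powRr1.
have vE : (v `^ p) `^ p^-1 = v by rewrite -powRrM mulfV ?gt_eqF// powRr1.
apply/idP/idP => h.
  by rewrite -[ltLHS]sE; apply: gt0_ltr_powR; rewrite ?nnegrE ?powR_ge0.
by rewrite -[ltRHS]vE; apply: gt0_ltr_powR; rewrite ?nnegrE ?powR_ge0.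
Qed.

Lemma step_dist (I : finType) (C : I -> set R) (m v : I -> R) phi s :
  cells01 C -> step_on C v phi -> (forall i, mu (C i) = (m i)%:E) -> 0 <= s ->
  dist phi s = (\sum_i m i * (s < v i)%R%:R)%:E.
Proof.
move=> [mC C01 dC] [phiC phi0] muC s0.
pose D i := if s < v i then C i else set0.
have -> : dist phi s = mu (\bigcup_(i in [set` index_enum I]) D i).
  congr (mu _); apply/seteqP; split => u /=.
    rewrite in_itv/= => -[u01 su].
    have [[i Ci]|nC] := pselect (exists i, C i u).
      exists i => /=; first by rewrite mem_index_enum.
      by rewrite /D -(phiC i u Ci) su.
    move: su; rewrite phi0//; first by rewrite ltNge s0.
    by move=> i Ci; apply: nC; exists i.
  move=> [i _]; rewrite /D; case: ifP => // sv Ci.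
  by rewrite (phiC i u Ci); split => //; exact: (C01 i).
rewrite measure_fin_bigcup//; last 2 first.
- move=> i j _ _ [u []]; rewrite /D; case: ifP => // _ Ci; case: ifP => // _ Cj.
  exact: dC Ci Cj.
- by move=> i _; rewrite /D; case: ifP => // _; exact: mC.
rewrite -fsbig_seq ?index_enum_uniq// -sumEFin; apply: eq_bigr => i _.
rewrite /D; case: ifP => _; rewrite ?mulr1 ?mulr0 ?measure0//; exact: muC.
Qed.

(** Each cell contributes its measure times the length of ]l, v^p[. The tail condition of
    [capped_majorization] thus becomes a finite inequality between sums of hinge functions max(0,
    v^p - l). *)
Lemma step_tail_integral (I : finType) (C : I -> set R) (m v : I -> R) phi p (l : R) :
  cells01 C -> step_on C v phi -> (forall i, mu (C i) = (m i)%:E) ->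
  (forall i, 0 <= v i) -> 0 < p -> 0 <= l ->
  (\int[mu]_(s in `]l, +oo[) dist phi (s `^ p^-1)%R)%E =
  (\sum_i m i * Num.max 0 (v i `^ p - l))%:E.
Proof.
move=> cC sC muC v0 p0 l0.
have m0 i : 0 <= m i by rewrite -lee_fin -muC.
have mI (i : interval R) : measurable [set` i] by exact: measurable_itv.
transitivity (\int[mu]_(s in `]l, +oo[)
    \sum_i ((m i)%:E * (\1_(`]-oo, (v i `^ p)[%classic : set R) s)%:E)%E)%E.
  apply: eq_integral => s; rewrite inE/= in_itv/= andbT => ls.
  have s0 := le_lt_trans l0 ls.
  rewrite (step_dist cC sC muC) ?powR_ge0// -sumEFin; apply: eq_bigr => i _.
  rewrite EFinM; congr (_ * (_%:R)%:E)%E; rewrite mem_setE in_itv/=.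
  by rewrite powR_inv_lt// ltW.
rewrite ge0_integral_sum//; last 2 first.
- move=> i; apply: measurable_funeM; apply/measurable_EFinP.
  by apply: measurable_indic; exact: mI.
- by move=> i s _; rewrite mule_ge0// lee_fin.
rewrite -sumEFin; apply: eq_bigr => i _.
rewrite ge0_integralZl ?lee_fin//; last first.
  apply/measurable_EFinP; apply: measurable_indic; exact: mI.
rewrite integral_indic// setIC EFinM; congr (_ * _)%E.
rewrite (_ : _ `&` _ = `]l, (v i `^ p)[%classic); last first.
  by apply/seteqP; split => s /=; rewrite !in_itv/= andbT => /andP.
rewrite /= lebesgue_measure_itv/= lte_fin; case: ltP => lv.
  by rewrite max_r ?subr_ge0 ?(ltW lv)// EFinB.
by rewrite max_l ?subr_le0.
Qed.

Definition split_step (I : finType) (A B : I -> set R) (b : I -> R) (x y : R)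
    (phi : R -> R) :=
  [/\ forall i u, B i u -> phi u = x * b i,
      forall i u, A i u -> ~ B i u -> phi u = y * b i &
      forall u, 0 <= u <= 1 -> (forall i, ~ A i u) -> phi u = 0].

Definition quarter (A B : set R) :=
  [/\ measurable B, B `<=` A & mu B = ((4^-1 : R)%:E * mu A)%E].

(* By majorization of [(x, y, y, y)] by [(x', y', y', y')], applied to the
   [p]-th powers on each cell. *)
Lemma lnorm_split_step_le (I : finType) (A B : I -> set R) (b : I -> R)
    (x y x' y' : R) w p phi psi :
  lorentz_weight w -> 0 < p -> nonneg_measurable01 phi -> nonneg_measurable01 psi ->
  cells01 A -> (forall i, quarter (A i) (B i)) -> (forall i, 0 <= b i) ->
  split_step A B b x y phi -> split_step A B b x' y' psi ->
  0 <= x -> 0 <= y -> 0 <= x' -> 0 <= y' ->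
  y' `^ p <= y `^ p -> y `^ p <= x `^ p -> x `^ p <= x' `^ p ->
  x `^ p + 3 * y `^ p <= x' `^ p + 3 * y' `^ p ->
  (lnorm w p phi <= lnorm w p psi)%E.
Proof.
move=> ww p0 mphi mpsi cA qB b0 sphi spsi x0 y0 x'0 y'0 yy yx xx xy.
have muA i : mu (A i) = (fine (mu (A i)))%:E.
  rewrite fineK// ge0_fin_numE; last exact: measure_ge0.
  case: cA => mA A01 _; apply: (@le_lt_trans _ _ (mu (`[0, 1] : set R))).
    by apply: le_measure; rewrite ?inE; [exact: mA|exact: measurable_itv|exact: A01].
  by rewrite mu01 ltry.
pose m i := fine (mu (A i)).
have m0 i : 0 <= m i by rewrite fine_ge0//; exact: measure_ge0.
(* Each cell is cut in two: index [true] is the quarter, [false] the remaining three quarters. *)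
pose C (j : I * bool) := if j.2 then B j.1 else A j.1 `\` B j.1.
pose mC (j : I * bool) := if j.2 then m j.1 / 4 else 3 * m j.1 / 4.
have muB i : mu (B i) = (m i / 4)%:E.
  by case: (qB i) => _ _ ->; rewrite muA -EFinM mulrC.
have cC : cells01 C.
  case: cA => mA A01 dA; split.
  - move=> [i []]; rewrite /C/=; case: (qB i) => mB _ _ //.
    exact: measurableD.
  - move=> [i []]; rewrite /C/= => u; case: (qB i) => _ BA _.
      by move=> /BA; exact: A01.
    by move=> [+ _]; exact: A01.
  - have CA j u : C j u -> A j.1 u.
      by case: j => i [] /=; rewrite /C/=; [case: (qB i) => _ BA _ /BA|case].
    move=> [i c] [j d] u Cu Du.
    have ij : i = j by exact: (dA i j u (CA _ _ Cu) (CA _ _ Du)).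
    rewrite ij in Cu *; congr (_, _).
    by case: c Cu; case: d Du => Du Cu //; [case: Du => _ /(_ Cu)|case: Cu => _ /(_ Du)].
have muC j : mu (C j) = (mC j)%:E.
  case: j => i []; rewrite /C /mC/=; first exact: muB.
  case: (qB i) => mB BA _; case: cA => mA _ _.
  rewrite measureD; [|exact: mA|exact: mB|by rewrite /= muA ltry].
  rewrite setIidr//= muB muA -EFinB; congr EFin; rewrite /m; by field.
have vE z t f : split_step A B b z t f ->
    step_on C (fun j => if j.2 then z * b j.1 else t * b j.1) f.
  move=> [fB fA f0]; split.
    by move=> [i []] u; rewrite /C/=; [exact: fB|case; exact: fA].
  move=> u u01 h; apply: f0 => // i Ai.
  have [Bi|nBi] := pselect (B i u); first exact: (h (i, true)).
  exact: (h (i, false)).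
have v0 z t : 0 <= z -> 0 <= t -> forall j : I * bool,
    0 <= (if j.2 then z * b j.1 else t * b j.1).
  by move=> z0 t0 [i []] /=; rewrite mulr_ge0.
suff H c : 0 <= c <= 1 -> (capped p phi c%:E <= 1%:E * capped p psi c%:E)%E.
  have := lnorm_le_scale ww p0 mphi mpsi ler01 H.
  by move: (lnorm w p phi) (lnorm w p psi) => X Y; rewrite mul1e.
move=> /andP[c0 _]; rewrite mul1e; apply: capped_majorization => // l l0.
rewrite (step_tail_integral cC (vE _ _ _ sphi) muC (v0 _ _ x0 y0) p0 l0).
rewrite (step_tail_integral cC (vE _ _ _ spsi) muC (v0 _ _ x'0 y'0) p0 l0).
rewrite lee_fin.
rewrite -(pair_bigA _ (fun i c =>
  mC (i, c) * Num.max 0 ((if c then x * b i else y * b i) `^ p - l)))/=.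
rewrite -(pair_bigA _ (fun i c =>
  mC (i, c) * Num.max 0 ((if c then x' * b i else y' * b i) `^ p - l)))/=.
apply: ler_sum => i _; rewrite !big_bool/= /mC/= !powRM//.
set X := b i `^ p.
have X0 : 0 <= X by exact: powR_ge0.
have h1 := ler_wpM2r X0 yy; have h2 := ler_wpM2r X0 yx.
have h3 := ler_wpM2r X0 xx; have h4 := ler_wpM2r X0 xy.
rewrite !mulrDl -!mulrA in h4.
move: (x `^ p * X) (y `^ p * X) (x' `^ p * X) (y' `^ p * X) h1 h2 h3 h4.
move=> X1 Y1 X2 Y2 h1 h2 h3 h4.
have -> : m i / 4 * Num.max 0 (X1 - l) + 3 * m i / 4 * Num.max 0 (Y1 - l) =
  m i / 4 * (Num.max 0 (X1 - l) + 3 * Num.max 0 (Y1 - l)) by field.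
have -> : m i / 4 * Num.max 0 (X2 - l) + 3 * m i / 4 * Num.max 0 (Y2 - l) =
  m i / 4 * (Num.max 0 (X2 - l) + 3 * Num.max 0 (Y2 - l)) by field.
apply: ler_wpM2l; first by rewrite divr_ge0.
(* The larger side enters only through these lower bounds. If both hinges on the left are active,
   the inequality of totals concludes; if only that of [X1] is, X1 <= X2 does; [Y1] alone cannot be
   active, as Y1 <= X1. *)
have u0 : 0 <= Num.max 0 (X2 - l) by rewrite le_max lexx.
have u1 : X2 - l <= Num.max 0 (X2 - l) by rewrite le_max lexx orbT.
have v0' : 0 <= Num.max 0 (Y2 - l) by rewrite le_max lexx.
have v1 : Y2 - l <= Num.max 0 (Y2 - l) by rewrite le_max lexx orbT.
move: (Num.max 0 (X2 - l)) (Num.max 0 (Y2 - l)) u0 u1 v0' v1 => u v u0 u1 v0' v1.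
by case: (leP 0 (X1 - l)) => ?; case: (leP 0 (Y1 - l)) => ?; lra.
Qed.
End Step.

(** * Real and complex scalars *)

Section Scalar.
Variables (R : realType) (k : scalar_kind).
Notation K := (scalar_field R k).

Definition scalar_of : R -> K :=
  match k return R -> scalar_field R k with
  | real_scalars => fun r => r
  | complex_scalars => fun r => Complex r 0
  end.

Definition re_part : K -> R :=
  match k return scalar_field R k -> R with
  | real_scalars => fun x : R => x
  | complex_scalars => fun z : R[i] => complex.Re z
  end.

Definition im_part : K -> R :=
  match k return scalar_field R k -> R with
  | real_scalars => fun=> 0
  | complex_scalars => fun z : R[i] => complex.Im z
  end.

Definition of_parts : R -> R -> K :=
  match k return R -> R -> scalar_field R k with
  | real_scalars => fun a b => a
  | complex_scalars => fun a b => Complex a b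
  end.
End Scalar.

Section ScalarTheory.
Variables (R : realType) (k : scalar_kind).
Notation K := (scalar_field R k).
Implicit Types x y : K.

Lemma modulus_ge0 x : 0 <= modulus x.
Proof.
case: k x => [x|[a b]] /=; first exact: normr_ge0.
exact: sqrtr_ge0.
Qed.

Lemma modulusD x y : modulus (x + y) <= modulus x + modulus y.
Proof. by case: k x y => x y /=; [exact: ler_normD|exact: le_normcD]. Qed.

Lemma modulusM x y : modulus (x * y) = modulus x * modulus y.
Proof.
by case: k x y => x y /=; [exact: normrM|exact: ComplexField.Normc.normcM].
Qed.

Lemma modulus0 : modulus (0 : K) = 0.
Proof. by case: k => /=; [exact: normr0|exact: ComplexField.Normc.normc0]. Qed.

Lemma modulus1 : modulus (1 : K) = 1.
Proof. by case: k => /=; [exact: normr1|exact: ComplexField.Normc.normc1]. Qed.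

Lemma modulusN x : modulus (- x) = modulus x.
Proof. by case: k x => x /=; [exact: normrN|exact: normcN]. Qed.

Lemma modulus_eq0 x : modulus x = 0 -> x = 0.
Proof.
by case: k x => x /=; [exact: normr0_eq0|exact: ComplexField.Normc.eq0_normc].
Qed.

Lemma modulus_scalar_of (r : R) : modulus (scalar_of k r) = `|r|.
Proof. by case: k => //=; rewrite expr0n/= addr0 sqrtr_sqr. Qed.

Lemma scalar_of_natD (n : nat) (r : R) :
  n%:R + scalar_of k r = scalar_of k (n%:R + r).
Proof.
case: k => //=.
have -> : (n%:R : R[i]) = (n%:R)%:C%C by rewrite rmorph_nat.
by apply/eqP; rewrite eq_complex /= addr0 !eqxx.
Qed.

Lemma modulus_nat (n : nat) : modulus (n%:R : K) = n%:R.
Proof.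
rewrite -[_%:R](addr0 (n%:R : K)).
have <- : scalar_of k (0 : R) = 0 by case: k.
by rewrite scalar_of_natD modulus_scalar_of addr0 ger0_norm.
Qed.

Lemma re_part_le x : `|re_part x| <= modulus x.
Proof.
case: k x => [x //|[a b]] /=; rewrite -sqrtr_sqr ler_wsqrtr//.
by rewrite lerDl sqr_ge0.
Qed.

Lemma im_part_le x : `|im_part x| <= modulus x.
Proof.
case: k x => [x|[a b]] /=; first by rewrite normr0.
by rewrite -sqrtr_sqr ler_wsqrtr// lerDr sqr_ge0.
Qed.

Lemma modulus_sub_parts x (a b : R) :
  modulus (x - of_parts k a b) <= `|re_part x - a| + `|im_part x - b|.
Proof.
case: k x => [x|[c d]] /=; first by rewrite lerDl.
rewrite (_ : `|c - a| + `|d - b| = Num.sqrt ((`|c - a| + `|d - b|) ^+ 2)); last first.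
  by rewrite sqrtr_sqr [RHS]ger0_norm ?addr_ge0.
apply: ler_wsqrtr; rewrite [leRHS]sqrrD !real_normK ?num_real// addrAC lerDl.
by rewrite mulrn_wge0// mulr_ge0.
Qed.

(** Over the complex numbers too, 1 has only the square roots 1 and -1, so the real part decides
    which one occurs. This makes the splitting given by richness a measurable set. *)
Lemma sqr_eq1_re x : x ^+ 2 = 1 -> x = (if 0 < re_part x then 1 else -1).
Proof.
move=> /eqP; rewrite sqrf_eq1 => /orP[] /eqP ->.
  by case: k => /=; rewrite ltr01.
by case: k => /=; rewrite ?oppr_gt0 ltr10.
Qed.

Lemma scalar_measurable_cst (D : set R) x : scalar_measurable D (fun=> x).
Proof. by case: k x => x /=; [|split]; exact: measurable_cst. Qed.

Lemma scalar_measurable_lincomb (D : set R) x (f g : R -> K) :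
  scalar_measurable D f -> scalar_measurable D g ->
  scalar_measurable D (fun t => x * f t + g t).
Proof.
case: k x f g => [x f g mf mg|[a b] f g [mf1 mf2] [mg1 mg2]] /=.
  by apply: measurable_funD => //; apply: measurable_funM => //; exact: measurable_cst.
split.
  rewrite (_ : (fun t => _) = (fun t => a * complex.Re (f t) -
      b * complex.Im (f t) + complex.Re (g t))); last first.
    by apply/funext => t; case: (f t) (g t) => [? ?] [].
  apply: measurable_funD => //; apply: measurable_funB;
    by apply: measurable_funM => //; exact: measurable_cst.
rewrite (_ : (fun t => _) = (fun t => a * complex.Im (f t) +
    b * complex.Re (f t) + complex.Im (g t))); last first.
  by apply/funext => t; case: (f t) (g t) => [? ?] [].
apply: measurable_funD => //; apply: measurable_funD;
  by apply: measurable_funM => //; exact: measurable_cst.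
Qed.

Lemma scalar_measurable_indic (D A : set R) : measurable A ->
  scalar_measurable D (\1_A : R -> K).
Proof.
move=> mA; case: k => /=; first exact: measurable_indic.
split.
  rewrite (_ : (fun t => _) = \1_A); first exact: measurable_indic.
  by apply/funext => t; rewrite !indicE; case: (t \in A).
rewrite (_ : (fun t => _) = cst 0); first exact: measurable_cst.
by apply/funext => t; rewrite !indicE; case: (t \in A).
Qed.

Lemma scalar_measurable_sum (D : set R) (I : Type) (s : seq I) (a : I -> K)
    (f : I -> R -> K) : (forall i, scalar_measurable D (f i)) ->
  scalar_measurable D (fun t => \sum_(i <- s) a i * f i t).
Proof.
move=> mf; elim: s => [|i s IHs].
  under eq_fun do rewrite big_nil; exact: scalar_measurable_cst.
by under eq_fun do rewrite big_cons; exact: scalar_measurable_lincomb.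
Qed.

Lemma re_part_measurable (D : set R) (f : R -> K) : scalar_measurable D f ->
  measurable_fun D (fun t => re_part (f t)).
Proof. by case: k f => /= [//|f []]. Qed.

Lemma im_part_measurable (D : set R) (f : R -> K) : scalar_measurable D f ->
  measurable_fun D (fun t => im_part (f t)).
Proof. by case: k f => /= [f _|f [] //]; exact: measurable_cst. Qed.

Lemma modulus_measurable (f : R -> K) : scalar_measurable `[0, 1]%classic f ->
  nonneg_measurable01 (fun t => modulus (f t)).
Proof.
move=> mf; split; last by move=> u; exact: modulus_ge0.
case: k f mf => [f|f [m1 m2]] /=; first exact: measurableT_comp.
rewrite (_ : (fun t => _) = (@Num.sqrt R) \o
    (fun t => complex.Re (f t) ^+ 2 + complex.Im (f t) ^+ 2)); last first.
  by apply/funext => t /=; case: (f t).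
apply: measurableT_comp; first exact: (continuous_measurable_fun (@sqrt_continuous R)).
by apply: measurable_funD; exact: measurable_funX.
Qed.
End ScalarTheory.

Lemma EFin_mul_lt (R : realType) (c e : R) (x : \bar R) :
  0 < c -> (x < (e / c)%:E)%E -> (c%:E * x < e%:E)%E.
Proof.
move=> c0 h; have -> : e%:E = (c%:E * (e / c)%:E)%E.
  by rewrite -EFinM mulrC divfK// gt_eqF.
by rewrite lte_pmul2l.
Qed.

(** * Lorentz norms of scalar functions *)

Section AlmostEverywhere.
Variable R : realType.
Notation mu := (@lebesgue_measure R).
Implicit Types P Q S : R -> Prop.

Lemma ae01_impl P Q : {ae mu, forall u, `[0, 1]%classic u -> P u} ->
  (forall u, 0 <= u <= 1 -> P u -> Q u) ->
  {ae mu, forall u, `[0, 1]%classic u -> Q u}.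
Proof.
move=> [N [mN N0 h]] PQ; exists N; split => // u /= nQ; apply: h => /= Pu.
by apply: nQ => u01; apply: PQ; [move: u01; rewrite /= in_itv|exact: Pu].
Qed.

Lemma ae01_impl2 P Q S : {ae mu, forall u, `[0, 1]%classic u -> P u} ->
  {ae mu, forall u, `[0, 1]%classic u -> Q u} ->
  (forall u, 0 <= u <= 1 -> P u -> Q u -> S u) ->
  {ae mu, forall u, `[0, 1]%classic u -> S u}.
Proof.
move=> [N [mN N0 hN]] [M [mM M0 hM]] PQS.
exists (N `|` M); split; first exact: measurableU.
  apply/eqP; rewrite eq_le measure_ge0 andbT.
  have := measureU2 mu mN mM; rewrite (_ : (_ + _)%E = 0%E)//.
  by rewrite -[RHS]adde0; congr (_ + _)%E.
move=> u /= nS; have [Pu|nP] := pselect (`[0, 1]%classic u -> P u); last first.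
  by left; apply: hN.
right; apply: hM => /= Qu; apply: nS => u01.
by apply: PQS; [move: u01; rewrite /= in_itv|exact: Pu|exact: Qu].
Qed.

Lemma ae_eq01_sym (T : Type) (f g : R -> T) : ae_eq01 f g -> ae_eq01 g f.
Proof. by move=> fg; apply: (ae01_impl fg) => u _ ->. Qed.

Lemma ae_eq01_trans (T : Type) (f g h : R -> T) :
  ae_eq01 f g -> ae_eq01 g h -> ae_eq01 f h.
Proof. by move=> fg gh; apply: (ae01_impl2 fg gh) => u _ -> ->. Qed.
End AlmostEverywhere.

#[global] Opaque lnorm.

Lemma EFin_mul_lty (R : realType) (c : R) (x : \bar R) :
  0 <= c -> (x < +oo)%E -> (c%:E * x < +oo)%E.
Proof. by move=> c0 xy; apply: lte_mul_pinfty. Qed.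

Section KNorm.
Variables (R : realType) (k : scalar_kind) (w : R -> R) (p : R).
Hypotheses (ww : lorentz_weight w) (p0 : 0 < p).
Notation K := (scalar_field R k).
Notation mu := (@lebesgue_measure R).
Implicit Types f g h : R -> K.

Definition knorm f : \bar R := lnorm w p (fun u => modulus (f u)).
Definition measurable01 f : Prop := scalar_measurable `[0, 1]%classic f.

Lemma knorm_ge0 f : (0 <= knorm f)%E.
Proof. exact: lnorm_ge0. Qed.

Lemma lorentz_normE f : lorentz_norm w p f = (knorm f `^ p^-1)%E.
Proof. reflexivity. Qed.

Let pV0 : 0 < p^-1. Proof. by rewrite invr_gt0. Qed.

Lemma le_lorentz_norm f (e : R) : 0 <= e -> (e%:E <= knorm f)%E ->
  ((e `^ p^-1)%:E <= lorentz_norm w p f)%E.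
Proof.
move=> e0 h; rewrite lorentz_normE -poweR_EFin.
apply: gt0_ler_poweR => //; rewrite ?(ltW pV0)// in_itv/=.
- by rewrite lee_fin e0 leey.
- by rewrite knorm_ge0 leey.
Qed.

Lemma ge_lorentz_norm f (e : R) : 0 <= e -> (knorm f <= e%:E)%E ->
  (lorentz_norm w p f <= (e `^ p^-1)%:E)%E.
Proof.
move=> e0 h; rewrite lorentz_normE -poweR_EFin.
apply: gt0_ler_poweR => //; rewrite ?(ltW pV0)// in_itv/=.
- by rewrite knorm_ge0 leey.
- by rewrite lee_fin e0 leey.
Qed.

Lemma lorentz_norm_lt f (e : R) : 0 <= e ->
  (lorentz_norm w p f < (e `^ p^-1)%:E)%E -> (knorm f < e%:E)%E.
Proof.
by move=> e0; apply: contraTT; rewrite -!leNgt; exact: le_lorentz_norm.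
Qed.

Lemma lorentz_spaceP f :
  lorentz_space w p f <-> measurable01 f /\ (knorm f < +oo)%E.
Proof.
split=> -[mf h]; split => //.
  by apply: lty_poweRy h; rewrite gt_eqF.
exact: poweR_lty.
Qed.

Lemma measurable01_modulus f : measurable01 f ->
  nonneg_measurable01 (fun u => modulus (f u)).
Proof. exact: modulus_measurable. Qed.

Lemma measurable01_lincomb (a : K) f g : measurable01 f -> measurable01 g ->
  measurable01 (fun t => a * f t + g t).
Proof. exact: scalar_measurable_lincomb. Qed.

Lemma measurable01_sub f g : measurable01 f -> measurable01 g ->
  measurable01 (fun t => f t - g t).
Proof.
move=> mf mg; rewrite (_ : (fun t => _) = (fun t => -1 * g t + f t)).
  exact: measurable01_lincomb.
by apply/funext => t; rewrite mulN1r addrC.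
Qed.

Lemma measurable01_scale (a : K) f : measurable01 f -> measurable01 (fun t => a * f t).
Proof.
move=> mf; rewrite (_ : (fun t => _) = (fun t => a * f t + (fun=> 0) t)).
  by apply: measurable01_lincomb => //; exact: scalar_measurable_cst.
by apply/funext => t; rewrite addr0.
Qed.

Lemma knorm_ae_le f g : measurable01 f -> measurable01 g ->
  {ae mu, forall u, `[0, 1]%classic u -> modulus (f u) <= modulus (g u)} ->
  (knorm f <= knorm g)%E.
Proof. by move=> mf mg; apply: ae_le_lnorm => //; exact: measurable01_modulus. Qed.

Lemma knorm_ae_eq f g : measurable01 f -> measurable01 g ->
  ae_eq01 f g -> knorm f = knorm g.
Proof.
move=> mf mg fg; apply/eqP; rewrite eq_le; apply/andP; split.
  by apply: knorm_ae_le => //; apply: (ae01_impl fg) => u _ ->.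
by apply: knorm_ae_le => //; apply: (ae01_impl fg) => u _ ->.
Qed.

Lemma knorm_quasi_triangle (a b : R) f g h : 0 < a -> 0 < b ->
  a^-1 + b^-1 <= 1 -> measurable01 f -> measurable01 g -> measurable01 h ->
  (forall u, 0 <= u <= 1 -> h u = f u + g u) ->
  (knorm h <= (a `^ p)%:E * knorm f + (b `^ p)%:E * knorm g)%E.
Proof.
move=> a0 b0 ab mf mg mh hE.
apply: lnorm_quasi_triangle => //; try exact: measurable01_modulus.
by move=> u u01; rewrite hE//; exact: modulusD.
Qed.

Lemma knormD f g h : measurable01 f -> measurable01 g -> measurable01 h ->
  (forall u, 0 <= u <= 1 -> h u = f u + g u) ->
  (knorm h <= (2 `^ p)%:E * (knorm f + knorm g))%E.
Proof.
move=> mf mg mh hE; rewrite muleDr//; last first.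
  by apply: ge0_adde_def; rewrite inE knorm_ge0.
by apply: knorm_quasi_triangle => //; lra.
Qed.

Lemma knormZ (a : K) f : measurable01 f -> a != 0 ->
  knorm (fun t => a * f t)%R = ((modulus a `^ p)%:E * knorm f)%E.
Proof.
move=> mf a0.
have ma : 0 < modulus a.
  rewrite lt_neqAle modulus_ge0 andbT eq_sym; apply: contra a0 => /eqP h.
  by rewrite (modulus_eq0 h).
rewrite /knorm -(lnorm_scale ww p0 ma (measurable01_modulus mf)).
by congr (lnorm w p _); apply/funext => t; exact: modulusM.
Qed.

Lemma knorm_eq0 f : measurable01 f -> (forall u, 0 <= u <= 1 -> f u = 0) -> knorm f = 0%E.
Proof.
move=> mf f0; apply: dist_eq0_lnorm => //; first exact: measurable01_modulus.
rewrite /dist (_ : _ `&` _ = set0) ?measure0//.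
apply/seteqP; split => // u /=; rewrite in_itv/= => -[u01].
by rewrite f0// modulus0 ltxx.
Qed.

Lemma knormZ_le (a : K) f : measurable01 f ->
  (knorm (fun t => (a * f t)%R) <= ((modulus a + 1) `^ p)%:E * knorm f)%E.
Proof.
move=> mf; have [->|a0] := eqVneq a 0.
  rewrite knorm_eq0; last 2 first.
  - exact: measurable01_scale.
  - by move=> u _; rewrite mul0r.
  by rewrite mule_ge0 ?knorm_ge0// lee_fin powR_ge0.
rewrite knormZ//; apply: lee_wpmul2r; first exact: knorm_ge0.
rewrite lee_fin; apply: ge0_ler_powR; rewrite ?nnegrE ?modulus_ge0 ?(ltW p0)//.
  by rewrite addr_ge0 ?modulus_ge0.
by rewrite lerDl.
Qed.

Lemma lorentz_space_lincomb (a : K) f g : lorentz_space w p f ->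
  lorentz_space w p g -> lorentz_space w p (fun t => a * f t + g t).
Proof.
move=> /lorentz_spaceP[mf ff] /lorentz_spaceP[mg fg]; apply/lorentz_spaceP.
have maf := measurable01_scale a mf.
split; first exact: measurable01_lincomb.
have /le_lt_trans := @knormD (fun t => a * f t) g (fun t => a * f t + g t) maf mg
  (measurable01_lincomb a mf mg) (fun _ _ => erefl).
apply; apply: EFin_mul_lty; first exact: powR_ge0.
apply: lte_add_pinfty; last exact: fg.
apply: le_lt_trans (knormZ_le a mf) _.
by apply: EFin_mul_lty; first exact: powR_ge0.
Qed.

(** The threshold depends on the coefficients but not on the functions, so the accuracy can be fixed
    before richness is applied in each cell. *)
Lemma knorm_sum_small (I : Type) (s : seq I) (a : I -> K) (e : R) : 0 < e ->
  exists2 d : R, 0 < d & forall f : I -> R -> K, (forall i, measurable01 (f i)) ->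
    (forall i, (knorm (f i) < d%:E)%E) ->
    (knorm (fun t => (\sum_(i <- s) a i * f i t)%R) < e%:E)%E.
Proof.
elim: s e => [|i s IHs] e e0.
  exists 1 => // f mf _; rewrite knorm_eq0//.
  - exact: scalar_measurable_sum.
  - by move=> u _; rewrite big_nil.
pose c := 2 `^ p; have c0 : 0 < c by rewrite powR_gt0.
pose c' := (modulus (a i) + 1) `^ p.
have c'0 : 0 < c' by rewrite powR_gt0// ltr_wpDl ?modulus_ge0.
have e'0 : 0 < e / 2 / c by rewrite !divr_gt0.
have [d d0 hd] := IHs (e / 2 / c) e'0.
have d'0 : 0 < e / 2 / c / c' by rewrite divr_gt0.
exists (Num.min d (e / 2 / c / c')); first by rewrite lt_min d0 d'0.
move=> f mf hf.
have hi : (knorm (f i) < (e / 2 / c / c')%:E)%E.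
  by apply: lt_le_trans (hf i) _; rewrite lee_fin ge_min lexx orbT.
have hs : (knorm (fun t => (\sum_(j <- s) a j * f j t)%R) < (e / 2 / c)%:E)%E.
  apply: hd => // j; apply: lt_le_trans (hf j) _.
  by rewrite lee_fin ge_min lexx.
have /le_lt_trans := @knormD (fun t => a i * f i t) (fun t => \sum_(j <- s) a j * f j t)
  (fun t => \sum_(j <- i :: s) a j * f j t) (measurable01_scale _ (mf i))
  (scalar_measurable_sum _ _ mf) (scalar_measurable_sum _ _ mf)
  (fun t _ => big_cons _ _ _ _ _ _).
apply; apply: EFin_mul_lt; first exact: c0.
rewrite (_ : e / _ = e / 2 / c + e / 2 / c); last by rewrite -mulrDl -splitr.
rewrite EFinD; apply: lteD; last exact: hs.
by apply: le_lt_trans (knormZ_le _ (mf i)) _; apply: EFin_mul_lt; [exact: c'0|exact: hi].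
Qed.

Lemma indic_sum (I : finType) (A : I -> set R) (a : I -> K) i u :
  cells01 A -> A i u -> \sum_j a j * \1_(A j) u = a i :> K.
Proof.
move=> [_ _ dA] Ai; rewrite (bigD1 i)//= big1 ?addr0 => [|j ji].
  by rewrite indicE mem_set// mulr1.
rewrite indicE memNset ?mulr0// => Aj.
by move: ji; rewrite (dA _ _ _ Ai Aj) eqxx.
Qed.

Lemma indic_sum0 (I : finType) (A : I -> set R) (a : I -> K) u :
  (forall i, ~ A i u) -> \sum_j a j * \1_(A j) u = 0 :> K.
Proof. by move=> nA; rewrite big1// => j _; rewrite indicE memNset// mulr0. Qed.

End KNorm.

(** * Step functions and rich subspaces *)

Section Approx.
Variables (R : realType) (k : scalar_kind) (w : R -> R) (p : R).
Hypotheses (ww : lorentz_weight w) (p0 : 0 < p).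
Notation K := (scalar_field R k).
Notation mu := (@lebesgue_measure R).

(** The cells are the preimages of the half-open squares of a grid in the plane of real and
    imaginary parts, cut down to the set where the modulus is at most [N]. *)
Lemma grid_cells (f : R -> K) (N d : R) : measurable01 f -> 0 < d -> 0 <= N ->
  exists (I : finType) (A : I -> set R) (a : I -> K),
    [/\ cells01 A,
      forall i u, A i u -> modulus (f u) <= N /\ modulus (f u - a i) <= d &
      forall u, 0 <= u <= 1 -> modulus (f u) <= N -> exists i, A i u].
Proof.
(* Each of the two coordinates contributes at most [e] to the error. *)
move=> mf d0 N0; pose e := d / 2; have e0 : 0 < e by rewrite divr_gt0.
(* Number of half-open intervals of length [e], starting at -N, that cover [-N, N]; the successor is
   what includes the right end N. *)
pose M := (Num.truncn ((N + N) / e)).+1.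
pose c (i : 'I_M) : R := i%:R * e - N.
pose cell (i : 'I_M) : set R := `[c i, (c i + e)[%classic.
pose A (ij : 'I_M * 'I_M) : set R := `[0, 1] `&` [set u | modulus (f u) <= N] `&`
  ((fun u => re_part (f u)) @^-1` cell ij.1 `&`
   (fun u => im_part (f u)) @^-1` cell ij.2).
pose a (ij : 'I_M * 'I_M) : K := of_parts k (c ij.1) (c ij.2).
have mcell i : measurable (cell i) by exact: measurable_itv.
have m01 : measurable (`[0, 1] : set R) by exact: measurable_itv.
have inj (i j : 'I_M) r : cell i r -> cell j r -> i = j.
  rewrite /cell /= !in_itv/= /c => /andP[i1 i2] /andP[j1 j2].
  have le_nat (m n : nat) : m%:R * e < n%:R * e + e -> (m <= n)%N.
    by rewrite -ltnS -(ltr_nat R) -natr1 -(ltr_pM2r e0) mulrDl mul1r.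
  apply/val_inj/eqP; rewrite eqn_leq.
  by apply/andP; split; apply: le_nat; lra.
have ex r : `|r| <= N -> exists i, cell i r.
  rewrite ler_norml => /andP[rN Nr].
  have rN0 : 0 <= (r + N) / e by rewrite divr_ge0 ?(ltW e0)//; lra.
  have iM : (Num.truncn ((r + N) / e) < M)%N.
    rewrite ltnS; apply: Num.Theory.le_truncn.
    by rewrite ler_pM2r ?invr_gt0// lerD2r.
  exists (Ordinal iM); rewrite /cell /= in_itv/= /c/=.
  have /andP[h1 h2] := Num.Theory.truncn_itv rN0.
  rewrite ler_pdivlMr// in h1; rewrite ltr_pdivrMr// -natr1 mulrDl mul1r in h2.
  by apply/andP; split; lra.
have near (i : 'I_M) r : cell i r -> `|r - c i| <= e.
  rewrite /cell /= in_itv/= => /andP[h1 h2]; rewrite ler_norml.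
  by apply/andP; split; lra.
exists ('I_M * 'I_M)%type, A, a; split.
- split.
  + move=> ij; have [mm _] := measurable01_modulus mf.
    have -> : A ij = `[0, 1] `&` (fun u => modulus (f u)) @^-1` `]-oo, N] `&`
        (`[0, 1] `&` (fun u => re_part (f u)) @^-1` cell ij.1) `&`
        (`[0, 1] `&` (fun u => im_part (f u)) @^-1` cell ij.2).
      apply/seteqP; split => u /=; rewrite !in_itv/=; last by case=> [[[? ?] [_ ?]] [_ ?]].
      by case=> [[? ?] [? ?]].
    apply: measurableI; first apply: measurableI.
    - exact: (mm m01 _ (measurable_itv _)).
    - exact: (re_part_measurable mf m01 (mcell ij.1)).
    - exact: (im_part_measurable mf m01 (mcell ij.2)).
  + by move=> ij u [[]].
  + move=> [i j] [i' j'] u [_ [/= i1 j1]] [_ [/= i2 j2]].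
    by rewrite (inj _ _ _ i1 i2) (inj _ _ _ j1 j2).
- move=> [i j] u [[_ /= uN] [/= ui uj]]; split => //.
  apply: le_trans (modulus_sub_parts _ _ _) _; rewrite (_ : d = e + e).
    by apply: lerD; exact: near.
  by rewrite /e -splitr.
- move=> u u01 uN.
  have [i ui] := ex _ (le_trans (re_part_le _) uN).
  have [j uj] := ex _ (le_trans (im_part_le _) uN).
  by exists (i, j); split; [split => //=; rewrite in_itv|].
Qed.

Lemma measurable01_indic_sum (I : finType) (A : I -> set R) (a : I -> K) :
  (forall i, measurable (A i)) -> measurable01 (fun u => \sum_i a i * \1_(A i) u).
Proof.
by move=> mA; apply: scalar_measurable_sum => i; exact: scalar_measurable_indic.
Qed.

(** The error is at most the constant [d] where the modulus of [f] is at most [n], and the tail of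
    [f] elsewhere. Finiteness of the norm of 1 makes the constant part small, [lnorm_tail] the other
    one. *)
Lemma knorm_approx (f : R -> K) (e : R) : measurable01 f -> (knorm w p f < +oo)%E ->
  (lnorm w p (fun=> 1%R) < +oo)%E -> 0 < e ->
  exists (I : finType) (A : I -> set R) (a : I -> K),
    cells01 A /\ (knorm w p (fun u => f u - \sum_i a i * \1_(A i) u)%R < e%:E)%E.
Proof.
move=> mf ff f1 e0; have mmf := measurable01_modulus mf.
have [L [L0 LE]] : exists L : R, 0 <= L /\ lnorm w p (fun=> 1%R) = L%:E.
  exists (fine (lnorm w p (fun=> 1%R))); split.
    by apply: fine_ge0; exact: lnorm_ge0.
  by rewrite fineK// ge0_fin_numE//; exact: lnorm_ge0.
pose c := 2 `^ p; have c0 : 0 < c by rewrite powR_gt0.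
pose e1 := e / c / 2; have e10 : 0 < e1 by rewrite !divr_gt0.
have [n hn] := lnorm_tail ww p0 mmf ff e10.
(* Chosen so that the constant [d] has p-th power norm L e1 / (L + 1), which is strictly below
   [e1]. *)
pose d := (e1 / (L + 1)) `^ p^-1.
have L1 : 0 < L + 1 by rewrite ltr_wpDl.
have d0 : 0 < d by rewrite powR_gt0// divr_gt0.
have [I [A [a [cA near cover]]]] := grid_cells mf d0 (ler0n R n).
exists I, A, a; split => //; case: (cA) => mA _ _.
have mg : measurable01 (fun u => f u - \sum_i a i * \1_(A i) u).
  by apply: measurable01_sub => //; exact: measurable01_indic_sum.
have md := nonneg_measurable01_cst (ltW d0).
have mt : nonneg_measurable01 (fun u => if n%:R < modulus (f u) then modulus (f u) else 0).
  case: mmf => mmf _; split; last by move=> u; case: ifP => // _; exact: modulus_ge0.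
  apply: measurable_fun_if => //.
  - by apply: measurable_fun_ltr => //; exact: measurable_cst.
  - by apply: measurable_funS mmf => // u [].
have h2 : (2 : R)^-1 + 2^-1 <= 1 by lra.
have := @lnorm_quasi_triangle R w p 2 2 (fun=> d)
  (fun u => if n%:R < modulus (f u) then modulus (f u) else 0)
  (fun u => modulus (f u - \sum_i a i * \1_(A i) u)) ww p0 (ltr0Sn _ 1) (ltr0Sn _ 1)
  h2 md mt (measurable01_modulus mg).
rewrite -muleDr//; last by apply: ge0_adde_def; rewrite inE lnorm_ge0.
move=> H; apply: le_lt_trans (H _) _ => {H}.
  move=> u u01; have [le|gt] := leP (modulus (f u)) n%:R.
    have [i Ai] := cover u u01 le.
    by rewrite (indic_sum a cA Ai) addr0; exact: (near i u Ai).2.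
  rewrite indic_sum0 ?subr0 ?lerDr ?(ltW d0)// => i Ai.
  by move: gt; rewrite ltNge (near i u Ai).1.
apply: EFin_mul_lt; first exact: c0.
rewrite (_ : e / _ = e1 + e1); last by rewrite -splitr.
rewrite EFinD; apply: lteD; last exact: hn.
have := lnorm_scale ww p0 d0 (nonneg_measurable01_cst (@ler01 R)).
under [X in lnorm w p X]eq_fun do rewrite mulr1.
move=> ->; rewrite LE -EFinM lte_fin /d -powRrM mulVf ?gt_eqF// powRr1.
  by rewrite mulrAC ltr_pdivrMr// ltr_pM2l// ltrDl.
by rewrite divr_ge0 ?ltW.
Qed.

Variable Y : set (R -> K).
Hypothesis rY : rich_subspace w p Y.

(** The function x supplied by richness is almost everywhere 2 \1_B - \1_A, where B is the part of A
    with positive real part; mean zero then says that B has half the measure. The tolerance is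
    passed as e^(1/p) because [knorm] is a p-th power. *)
Lemma rich_half (A : set R) (e : R) : measurable A -> A `<=` `[0, 1] -> 0 < e ->
  exists (B : set R) (y : R -> K), [/\ measurable B, B `<=` A,
    mu B = ((2^-1 : R)%:E * mu A)%E, Y y &
    (knorm w p (fun t => (2 * \1_B t - \1_A t) - y t)%R < e%:E)%E].
Proof.
move=> mA A01 e0; case: rY => cY /(_ A (e `^ p^-1) mA A01 (powR_gt0 _ e0)).
move=> [y [x [Yy xL x2 x0 xy]]].
have yL : lorentz_space w p y by case: cY => + _ _ _; apply.
have [mx _] := (lorentz_spaceP w p0 x).1 xL.
have [my _] := (lorentz_spaceP w p0 y).1 yL.
have mre := re_part_measurable mx.
have m01 : measurable (`[0, 1] : set R) by exact: measurable_itv.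
(* As x^2 = \1_A holds only almost everywhere, the intersection with [A] is taken to have an
   inclusion at every point. *)
pose B := A `&` (`[0, 1] `&` (fun t => re_part (x t)) @^-1` `]0, +oo[).
have mB : measurable B.
  by apply: measurableI => //; exact: (mre m01 _ (measurable_itv _)).
have mh : measurable01 (fun t => 2 * \1_B t - \1_A t : K).
  apply: measurable01_sub; last exact: scalar_measurable_indic.
  by apply: measurable01_scale; exact: scalar_measurable_indic.
have xh : ae_eq01 x (fun t => 2 * \1_B t - \1_A t).
  apply: (ae01_impl x2) => u u01 xu; rewrite !indicE.
  have [uA|uA] := boolP (u \in A); last first.
    rewrite indicE (negbTE uA) in xu.
    rewrite in_setI (negbTE uA)/= mulr0 subr0; apply/eqP.
    by rewrite -(sqrf_eq0) xu.
  rewrite indicE uA in xu.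
  have -> : (u \in B) = (0 < re_part (x u)).
    apply/idP/idP; rewrite inE; first by case=> _ [_ /=]; rewrite in_itv/= andbT.
    by move=> h; split; [exact/set_mem|split => /=; rewrite in_itv/= ?andbT].
  rewrite {1}(sqr_eq1_re xu).
  by case: ifP => _; rewrite ?mulr1 ?mulr0 ?sub0r// mulr2n addrK.
have B01 : B `<=` `[0, 1] by move=> u [] /A01.
exists B, y; split => //; first by move=> u [].
  have int0 : (\int[mu]_(t in `[0%R, 1%R]) re_part (x t)) = 0.
    by move: x0; rewrite /re_part; case: (k) (x) => [f|f] /= h; [|case: h].
  have mui (C : set R) : measurable C -> C `<=` `[0, 1] ->
      (\int[mu]_(t in `[0%R, 1%R]) (\1_C t)%:E = mu C)%E.
    by move=> mC C01; rewrite integral_indic//; congr (mu _); exact/setIidPl.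
  have fin (C : set R) : measurable C -> C `<=` `[0, 1] -> mu C \is a fin_num.
    move=> mC C01; rewrite ge0_fin_numE ?measure_ge0//.
    apply: (@le_lt_trans _ _ (mu (`[0, 1] : set R))); last by rewrite mu01 ltry.
    by apply: le_measure; rewrite ?inE.
  have ind (C : set R) : measurable C -> C `<=` `[0, 1] ->
      mu.-integrable (`[0, 1] : set R) (fun t => (\1_C t)%:E).
    move=> mC C01; apply/integrableP; split.
      by apply/measurable_EFinP; exact: measurable_indic.
    under eq_integral do rewrite /= ger0_norm//.
    by rewrite mui// ltey_eq fin.
  have : (\int[mu]_(t in `[0%R, 1%R]) (re_part (x t))%:E =
      2%:E * mu B - mu A)%E.
    transitivity (\int[mu]_(t in `[0%R, 1%R]) (2%:E * (\1_B t)%:E - (\1_A t)%:E))%E.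
      apply: ae_eq_integral => //.
      - exact/measurable_EFinP.
      - apply: emeasurable_funB; last by apply/measurable_EFinP; exact: measurable_indic.
        by apply: measurable_funeM; apply/measurable_EFinP; exact: measurable_indic.
      apply: (ae01_impl xh) => u u01 ->; rewrite !indicE -EFinM -EFinB; congr EFin.
      case: (u \in A); case: (u \in B); case: (k) => /=;
        rewrite ?mulr1 ?mulr0 ?subr0 ?sub0r ?oppr0//.
    rewrite integralB//; last 2 first.
    - by apply: integrableZl => //; exact: ind.
    - exact: ind.
    by rewrite integralZl ?mui//; exact: ind.
  rewrite /Rintegral in int0.
  case: (mu A) (fin A mA A01) (mu B) (fin B mB B01) int0 => [a| |]// _ [b| |]// _ int0 E.
  rewrite E -EFinM -EFinB /= in int0.
  by rewrite -EFinM; congr EFin; lra.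
rewrite -(@knorm_ae_eq _ _ _ _ ww p0 (fun t => x t - y t)).
- exact: (lorentz_norm_lt ww p0 (ltW e0)).
- exact: measurable01_sub.
- exact: measurable01_sub.
- by apply: (ae01_impl xh) => u _ ->.
Qed.

Lemma closed_subspace_lincomb (a : K) f g : closed_subspace w p Y ->
  Y f -> Y g -> Y (fun t => a * f t + g t).
Proof. by case=> _ _ h _; exact: h. Qed.

(** Halving twice, with B2 in B1 in A, and the identity 4 \1_B2 - \1_A = 2 (2 \1_B2 - \1_B1) + (2
    \1_B1 - \1_A). *)
Lemma rich_quarter (A : set R) (e : R) : measurable A -> A `<=` `[0, 1] -> 0 < e ->
  exists (B : set R) (y : R -> K), [/\ quarter A B, Y y &
    (knorm w p (fun t => (4 * \1_B t - \1_A t) - y t)%R < e%:E)%E].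
Proof.
move=> mA A01 e0; have [cY _] := rY.
pose c := 2 `^ p; have c0 : 0 < c by rewrite powR_gt0.
have e10 : 0 < e / c / 2 by rewrite !divr_gt0.
have m2 : modulus (2 : K) = 2 by exact: modulus_nat.
(* The second halving is more accurate by a further factor 2^p, since its error is doubled in the
   identity. *)
have e20 : 0 < e / c / 2 / c by rewrite divr_gt0.
have [B1 [y1 [mB1 B1A muB1 Yy1 h1]]] := rich_half mA A01 e10.
have B101 : B1 `<=` `[0, 1] by exact: subset_trans B1A A01.
have [B2 [y2 [mB2 B2B1 muB2 Yy2 h2]]] := rich_half mB1 B101 e20.
have ysm y : Y y -> measurable01 y.
  by case: cY => YL _ _ _ /YL /(lorentz_spaceP w p0 y)[].
pose g1 t : K := (2 * \1_B1 t - \1_A t) - y1 t.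
pose g2 t : K := (2 * \1_B2 t - \1_B1 t) - y2 t.
have smh (B C : set R) (y : R -> K) (a : K) : measurable B -> measurable C -> Y y ->
    measurable01 (fun t => (a * \1_B t - \1_C t) - y t).
  move=> mB mC Yy; apply: measurable01_sub; last exact: ysm.
  apply: measurable01_sub; last exact: scalar_measurable_indic.
  by apply: measurable01_scale; exact: scalar_measurable_indic.
have Yy : Y (fun t => 2 * y2 t + y1 t) by exact: closed_subspace_lincomb.
exists B2, (fun t => 2 * y2 t + y1 t); split => //.
  split => //; first exact: subset_trans B2B1 B1A.
  by rewrite muB2 muB1 muleA -EFinM; congr (_%:E * _)%E; field.
have := @knormD R k w p ww p0 (fun t => 2 * g2 t) g1
  (fun t => (4 * \1_B2 t - \1_A t) - (2 * y2 t + y1 t)).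
move=> /(_ (measurable01_scale 2 (smh _ _ _ _ mB2 mB1 Yy2)) (smh _ _ _ _ mB1 mA Yy1)
  (smh _ _ _ _ mB2 mA Yy)).
move=> H; apply: le_lt_trans (H _) _ => {H}.
  by move=> u _; rewrite /g1 /g2; ring.
apply: EFin_mul_lt; first exact: c0.
rewrite (_ : e / _ = e / c / 2 + e / c / 2); last by rewrite -splitr.
rewrite EFinD; apply: lteD; last exact: h1.
have n2 : (2 : K) != 0 by rewrite pnatr_eq0.
rewrite (knormZ ww p0 (smh _ _ _ _ mB2 mB1 Yy2) n2).
rewrite m2; apply: EFin_mul_lt; [exact: c0|exact: h2].
Qed.

Lemma rich_step (I : finType) (A : I -> set R) (a : I -> K) (e : R) :
  cells01 A -> 0 < e ->
  exists (B : I -> set R) (y : R -> K),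
    [/\ forall i, quarter (A i) (B i), Y y &
      (knorm w p (fun t => \sum_i a i * (4 * \1_(B i) t - \1_(A i) t) - y t)%R
         < e%:E)%E].
Proof.
move=> [mA A01 _] e0; have [cY _] := rY.
have [d d0 hd] := knorm_sum_small ww p0 (index_enum I) a e0.
have := fun i => rich_quarter (mA i) (A01 i) d0.
move=> /choice[B /choice[y h]].
exists B, (fun t => \sum_i a i * y i t); split.
- by move=> i; case: (h i).
- elim: (index_enum I) => [|i s IHs].
    under eq_fun do rewrite big_nil; by case: cY.
  under eq_fun do rewrite big_cons.
  by apply: closed_subspace_lincomb => //; case: (h i).
- have := hd (fun i t => (4 * \1_(B i) t - \1_(A i) t) - y i t).
  under [X in knorm w p X]eq_fun do under eq_bigr do rewrite mulrBr.
  under [X in knorm w p X]eq_fun do rewrite sumrB.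
  apply.
  + move=> i; case: (h i) => -[mB _ _] Yy _.
    apply: measurable01_sub.
      apply: measurable01_sub; last exact: scalar_measurable_indic.
      by apply: measurable01_scale; exact: scalar_measurable_indic.
    by case: cY => YL _ _ _; case/YL/(lorentz_spaceP w p0 (y i)): Yy.
  + by move=> i; case: (h i).
Qed.
End Approx.

(** * Contraction constants *)

Section Constants.
Variables (R : realType) (p : R).
Hypothesis hp : 2 < p.

(* Young's inequality for [x] and [y^(p - 1)]. *)
Lemma powR_tangent (x y : R) : 0 <= x -> 0 < y ->
  y `^ p + p * y `^ (p - 1) * (x - y) <= x `^ p.
Proof.
move=> x0 y0; move: (hp) => p2; have p0 : 0 < p by lra.
have p1 : 0 < p - 1 by lra.
have := @conjugate_powR R x (y `^ (p - 1)) p (p / (p - 1)) x0 (powR_ge0 _ _) p0.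
rewrite divr_gt0// => /(_ isT); rewrite invf_div.
have -> : p^-1 + (p - 1) / p = 1 by field; rewrite gt_eqF.
move=> /(_ erefl); rewrite -powRrM.
have -> : (p - 1) * (p / (p - 1)) = p by field; rewrite gt_eqF.
have yE := mulr_powRB1 (ltW y0) p0.
rewrite -(ler_pM2l p0).
have -> : p * (x `^ p / p + y `^ p * ((p - 1) / p)) = x `^ p + y `^ p * (p - 1).
  by field; rewrite gt_eqF.
by rewrite -yE; lra.
Qed.

(* At [s = 0] both sides agree and the derivative of the left-hand side is
   [p (3 - 3^(p - 1)) < 0], because [p > 2]. *)
Lemma contraction_shift : exists s : R, [/\ 0 < s, s < 1 &
  (3 - s) `^ p + 3 * (1 + s) `^ p < 3 `^ p + 3].
Proof.
move: (hp) => p2; have p1 : 1 < p - 1 by lra.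
have p10 : 0 < p - 1 by lra.
(* The tangent inequalities below give a strict gain as soon as 3 (1 + s)^(p - 1) < (3 - s)^(p - 1),
   that is, (3 - s)/(1 + s) > t. The ratio is 3 at s = 0, and t < 3 because p > 2; so s is
   determined by prescribing the midpoint t' of t and 3 as the ratio. *)
pose t : R := 3 `^ (p - 1)^-1.
have t0 : 0 < t by rewrite powR_gt0.
have tp : t `^ (p - 1) = 3 by rewrite -powRrM mulVf ?gt_eqF// powRr1.
have t3 : t < 3.
  rewrite ltNge; apply/negP => t3.
  have : 3 `^ (p - 1) <= t `^ (p - 1).
    by apply: ge0_ler_powR => //; rewrite ?nnegrE; lra.
  rewrite tp -(@mulr_powRB1 _ 3 (p - 1))//; apply/negP; rewrite -ltNge.
  rewrite ltr_pMr//; have := @gt0_ltr_powR R (p - 1 - 1) _ 1 3.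
  by rewrite powR1 !nnegrE; apply; lra.
pose t' := (3 + t) / 2.
have t'0 : 1 < t' by rewrite /t'; lra.
have t'1 : 0 < 1 + t' by lra.
have t'p : 3 < t' `^ (p - 1).
  by rewrite -tp; apply: gt0_ltr_powR => //; rewrite ?nnegrE; rewrite /t'; lra.
pose s := (3 - t') / (1 + t').
have s0 : 0 < s by rewrite divr_gt0//; rewrite /t'; lra.
have s1 : s < 1 by rewrite ltr_pdivrMr// mul1r; lra.
have sE : 3 - s = t' * (1 + s) by rewrite /s; field; rewrite gt_eqF.
exists s; split => //.
(* Tangents are taken at the shifted points 3 - s and 1 + s and evaluated at 3 and 1: the shifted
   sum stands on the smaller side and the gain is explicit. *)
have h1 := @powR_tangent 3 (3 - s) (ler0n _ _) ltac:(lra).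
have h2 := @powR_tangent 1 (1 + s) ler01 ltac:(lra).
rewrite powR1 in h2.
have q0 : 0 < (1 + s) `^ (p - 1) by rewrite powR_gt0//; lra.
have h3 : 3 * (1 + s) `^ (p - 1) < (3 - s) `^ (p - 1).
  by rewrite sE powRM ?ltr_pM2r//; lra.
have h4 : 0 < p * s * ((3 - s) `^ (p - 1) - 3 * (1 + s) `^ (p - 1)).
  by rewrite mulr_gt0 ?subr_gt0// mulr_gt0//; lra.
by lra.
Qed.

(* [q^4 kappa = 1] where [kappa] is the gain of [lnorm_split_step_le]; three of
   the four factors [q] absorb [||P||] and two quasi-triangle inequalities. *)
Lemma contraction_constants : exists s q : R, [/\ 0 < s, s < 1, 1 < q &
  (3 - s) `^ p + 3 * (1 + s) `^ p = (q ^+ 4)^-1 * (3 `^ p + 3)].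
Proof.
have [s [s0 s1 h]] := contraction_shift.
have L0 : 0 < (3 - s) `^ p + 3 * (1 + s) `^ p.
  by rewrite addr_gt0 ?mulr_gt0 ?powR_gt0//; lra.
have M0 : 0 < 3 `^ p + 3 :> R by rewrite addr_gt0 ?powR_gt0.
pose k := (3 `^ p + 3) / ((3 - s) `^ p + 3 * (1 + s) `^ p).
have k1 : 1 < k by rewrite ltr_pdivlMr// mul1r.
have k0 : 0 < k by lra.
exists s, (k `^ (4^-1)); split => //.
  have := @gt0_ltr_powR R 4^-1 _ 1 k.
  by rewrite powR1 !nnegrE; apply; lra.
rewrite -powR_mulrn ?powR_ge0// -powRrM mulVf// powRr1 ?(ltW k0)//.
by rewrite /k invf_div divfK// gt_eqF.
Qed.
End Constants.

(** * Projections onto rich subspaces *)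

Lemma ge0_fin_real (R : realType) (x : \bar R) : (0 <= x)%E -> (x < +oo)%E ->
  exists2 r : R, 0 <= r & x = r%:E.
Proof. by case: x => [r| |]// r0 _; exists r. Qed.

Section NarrowPerturbation.
Variables (R : realType) (k : scalar_kind) (w : R -> R) (p : R).
Hypotheses (ww : lorentz_weight w) (p0 : 0 < p).
Notation K := (scalar_field R k).
Notation mu := (@lebesgue_measure R).
Implicit Types (f g : R -> K).

Section StepGain.
Variables (I : finType) (A B : I -> set R) (a : I -> K).
Hypotheses (cA : cells01 A) (qB : forall i, quarter (A i) (B i)).

(* The step function of [a] times the function equal to [3] on a quarter of each
   cell and to [-1] on the rest. *)
Definition quarter_sum (u : R) : K := \sum_i a i * (4 * \1_(B i) u - \1_(A i) u).

Lemma measurable01_quarter_sum : measurable01 quarter_sum.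
Proof.
case: cA => mA _ _; apply: scalar_measurable_sum => i; case: (qB i) => mB _ _.
apply: measurable01_sub; last exact: scalar_measurable_indic.
by apply: measurable01_scale; exact: scalar_measurable_indic.
Qed.

Lemma quarter_sum_in i u : A i u ->
  quarter_sum u = a i * (if u \in B i then 3 else -1).
Proof.
case: cA => _ _ dA Ai; rewrite /quarter_sum (bigD1 i)//= big1 ?addr0 => [|j ji].
  rewrite !indicE (mem_set Ai); case: (u \in B i) => /=; last by rewrite mulr0 sub0r.
  by rewrite mulr1; congr (_ * _); ring.
rewrite !indicE; have nA : ~ A j u.
  by move=> Aj; move: ji; rewrite (dA _ _ _ Ai Aj) eqxx.
rewrite (memNset nA) memNset ?mulr0 ?subr0 ?mulr0//.
by case: (qB j) => _ BA _ /BA.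
Qed.

Lemma quarter_sum_notin u : (forall i, ~ A i u) -> quarter_sum u = 0.
Proof.
move=> nA; rewrite /quarter_sum big1// => i _; rewrite !indicE (memNset (nA i)).
rewrite memNset ?mulr0 ?subr0 ?mulr0//.
by case: (qB i) => _ BA _ /BA; exact: nA.
Qed.

(** Pointwise, as the factors 3 and -1 have modulus at least 1. It bounds the norm of [f] by that of
    [quarter_sum], up to approximation, in the final contradiction. *)
Lemma knorm_indic_sum_le :
  (knorm w p (fun u => \sum_i a i * \1_(A i) u)%R <= knorm w p quarter_sum)%E.
Proof.
case: (cA) => mA _ _.
apply: knorm_ae_le => //; [exact: measurable01_indic_sum|exact: measurable01_quarter_sum|].
apply: aeW => u _; have [[i Ai]|nA] := pselect (exists i, A i u); last first.
  by rewrite indic_sum0 ?modulus0 ?modulus_ge0// => i Ai; apply: nA; exists i.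
rewrite (indic_sum a cA Ai) (quarter_sum_in Ai) modulusM ler_peMr ?modulus_ge0//.
by case: ifP => _; rewrite ?modulusN ?modulus1// modulus_nat ler1n.
Qed.

(** [kappa] is absorbed by scaling [quarter_sum] by kappa^(1/p): its p-th powers on the quarters
    become kappa (3^p, 1, 1, 1), with the same total as those of the shifted function, so that
    majorization applies. *)
Lemma knorm_shift_le (s kappa : R) : 0 < s -> s < 1 -> 0 < kappa -> kappa <= 1 ->
  (3 - s) `^ p + 3 * (1 + s) `^ p = kappa * (3 `^ p + 3) ->
  (knorm w p (fun u => quarter_sum u + scalar_of k (- s) * \sum_i a i * \1_(A i) u)%R
   <= kappa%:E * knorm w p quarter_sum)%E.
Proof.
move=> s0 s1 k0 k1 eqn.
have kp : (kappa `^ p^-1) `^ p = kappa.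
  by rewrite -powRrM mulVf ?gt_eqF// powRr1// ltW.
have K0 : 0 < kappa `^ p^-1 by rewrite powR_gt0.
have Y1 : 1 <= (1 + s) `^ p.
  by rewrite -[leLHS](powRr0 (1 + s)); apply: ler_powR; [lra|exact: ltW].
have mH := measurable01_modulus measurable01_quarter_sum.
have mG : measurable01 (fun u =>
    quarter_sum u + scalar_of k (- s) * \sum_i a i * \1_(A i) u).
  rewrite (_ : (fun u => _) = (fun u => scalar_of k (- s) * (\sum_i a i * \1_(A i) u) +
      quarter_sum u)); last by apply/funext => u; rewrite addrC.
  apply: measurable01_lincomb; last exact: measurable01_quarter_sum.
  by apply: measurable01_indic_sum; case: cA.
rewrite -[X in (X%:E * _)%E]kp -(lnorm_scale ww p0 K0 mH).
have sN : scalar_of k (- s) = - scalar_of k s.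
  by case: k => //=; apply/eqP; rewrite eq_complex /= oppr0 !eqxx.
apply: (@lnorm_split_step_le R I A B (fun i => modulus (a i))
  (3 - s) (1 + s) (kappa `^ p^-1 * 3) (kappa `^ p^-1)) => //.
- exact: measurable01_modulus.
- exact: nonneg_measurable01_scale (ltW K0) mH.
- by move=> i; exact: modulus_ge0.
- split.
  + move=> i u Bi; have Ai : A i u by case: (qB i) => _ BA _; exact: BA.
    rewrite (quarter_sum_in Ai) (indic_sum a cA Ai) (mem_set Bi) [_ * a i]mulrC -mulrDr.
    rewrite modulusM scalar_of_natD modulus_scalar_of mulrC; congr (_ * _).
    by rewrite ger0_norm//; lra.
  + move=> i u Ai nBi; rewrite (quarter_sum_in Ai) (indic_sum a cA Ai) (memNset nBi).
    rewrite [_ * a i]mulrC -mulrDr modulusM sN -opprD modulusN.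
    rewrite (scalar_of_natD k 1) modulus_scalar_of mulrC; congr (_ * _).
    by rewrite ger0_norm//; lra.
  + move=> u _ nA; rewrite quarter_sum_notin// indic_sum0// mulr0 addr0.
    exact: modulus0.
- split.
  + move=> i u Bi; have Ai : A i u by case: (qB i) => _ BA _; exact: BA.
    rewrite (quarter_sum_in Ai) (mem_set Bi) modulusM modulus_nat.
    by rewrite -mulrA; congr (_ * _); rewrite mulrC.
  + move=> i u Ai nBi; rewrite (quarter_sum_in Ai) (memNset nBi) modulusM modulusN.
    by rewrite modulus1 mulr1.
  + by move=> u _ nA; rewrite quarter_sum_notin// modulus0 mulr0.
- by lra.
- by lra.
- by rewrite mulr_ge0// ltW.
- exact: ltW.
- by rewrite kp (le_trans k1).
- by apply: ge0_ler_powR; rewrite ?nnegrE ?(ltW p0)//; lra.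
(* Equal totals together with kappa <= 1 <= (1 + s)^p force (3 - s)^p <= kappa 3^p. *)
- by rewrite powRM ?(ltW K0)// kp; lra.
- by rewrite powRM ?(ltW K0)// kp eqn; lra.
Qed.
End StepGain.

(* The error budget of [proj_norm_ge]: [X] is the norm of the step function, and
   the cycle of inequalities [X <= q V], [V <= q U], [U <= q G], [G <= q^-4 X]
   only fails to be contradictory by errors of order [e]. *)
Lemma perturbation_absurd (n0 X V U G F x1 x2 x3 h1 h2 q b c e : R) :
  1 < q -> 0 < c -> 0 <= b -> 0 < n0 ->
  e = n0 / (2 * (c * ((b + q * q * (b * (c * 2))) / (1 - q^-1) + 1))) ->
  n0 <= c * (F + h2) -> F <= X -> X <= q * V + b * h1 -> V <= q * U ->
  U <= q * G + b * x3 -> x3 <= c * (x1 + x2) -> G <= (q ^+ 4)^-1 * X ->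
  h1 < e -> h2 < e -> x1 < e -> x2 < e -> False.
Proof.
move=> q1 c0 b0 n0p.
set D := (b + _) / _ + 1 => eE hn hF hX hV hU hx hG h1e h2e x1e x2e.
have q0 : 0 < q by lra.
have qV : 0 < 1 - q^-1 by rewrite subr_gt0 invf_lt1.
have N0 : 0 <= b + q * q * (b * (c * 2)).
  by rewrite addr_ge0// !mulr_ge0// ltW.
have D0 : 0 < D by rewrite ltr_wpDl// divr_ge0// ltW.
have {}hn : n0 <= c * (F + e) by apply: (le_trans hn); rewrite ler_pM2l// lerD2l ltW.
have {}hX : X <= q * V + b * e.
  by apply: (le_trans hX); rewrite lerD2l ler_wpM2l// ltW.
have {}hU : U <= q * G + b * (c * (e + e)).
  apply: (le_trans hU); rewrite lerD2l ler_wpM2l//; apply: (le_trans hx).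
  by rewrite ler_pM2l//; lra.
have hV' : V <= q * (q * ((q ^+ 4)^-1 * X) + b * (c * (e + e))).
  apply: (le_trans hV); rewrite ler_pM2l//; apply: (le_trans hU).
  by rewrite lerD2r ler_pM2l.
(* Going once around the cycle multiplies [X] by q q q q^-4 = 1/q < 1, so [X] itself is of order
   [e]. *)
have hX' : X <= q^-1 * X + (b + q * q * (b * (c * 2))) * e.
  apply: (le_trans hX).
  rewrite (_ : q^-1 * X + _ = q * (q * (q * ((q ^+ 4)^-1 * X) + b * (c * (e + e)))) + b * e).
    by rewrite lerD2r ler_pM2l.
  by field; rewrite gt_eqF.
have hXe : X + e <= D * e.
  rewrite mulrDl mul1r lerD2r mulrAC ler_pdivlMr//; lra.
have : n0 <= c * (D * e).
  by apply: (le_trans hn); rewrite ler_pM2l//; lra.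
(* [e] was chosen to make this half of [n0], contradicting the bound just obtained. *)
have -> : c * (D * e) = n0 / 2 by rewrite eE; field; rewrite !gt_eqF.
lra.
Qed.

Section Projection.
Variables (Y : set (R -> K)) (P : (R -> K) -> (R -> K)).
Hypotheses (rY : rich_subspace w p Y) (pP : is_projection w p P)
  (YP : has_range w p P Y).

Let L : set (R -> K) := lorentz_space w p.
Let L_lincomb (a : K) f g (Lf : L f) (Lg : L g) : L (fun t => a * f t + g t) :=
  lorentz_space_lincomb ww p0 a Lf Lg.
Let LY y : Y y -> L y.
Proof. by case: rY => -[YL _ _ _] _; exact: YL. Qed.
Let Lsm f : L f -> measurable01 f.
Proof. by move=> /(lorentz_spaceP w p0)[]. Qed.
Let PL f : L f -> L (P f).
Proof. by case: pP => -[PL _ _ _] _; exact: PL. Qed.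

Lemma proj_fix y : Y y -> ae_eq01 (P y) y.
Proof.
move=> Yy; have Ly := LY Yy.
have [f Lf fy] := (YP Ly).1 Yy.
case: pP => -[_ Pae _ _] PP.
have h1 := Pae _ _ (PL Lf) Ly fy.
exact: ae_eq01_trans (ae_eq01_sym h1) (ae_eq01_trans (PP f Lf) fy).
Qed.

Lemma proj_kernel g : L g ->
  ae_eq01 (P (fun t => -1 * P g t + g t)) (fun=> 0).
Proof.
move=> Lg; case: pP => -[_ _ lin _] PP.
have := lin (-1) (P g) g (PL Lg) Lg => h.
apply: (ae01_impl2 h (PP g Lg)) => u _ -> ->.
by rewrite mulN1r addNr.
Qed.

Lemma proj_perturb (s : K) y f : Y y -> L f -> ae_eq01 (P f) (fun=> 0) ->
  ae_eq01 (P (fun t => s * f t + y t)) y.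
Proof.
move=> Yy Lf Pf; case: pP => -[_ _ lin _] _.
apply: (ae_eq01_trans (lin s f y Lf (LY Yy))).
by apply: (ae01_impl2 Pf (proj_fix Yy)) => u _ -> ->; rewrite mulr0 add0r.
Qed.

(** [operator_norm] is a supremum over the unit ball, so [f] is first scaled to norm 1; the scaling
    factor cancels after taking p-th powers. *)
Lemma knorm_proj_le (q : R) f : 0 < q ->
  (operator_norm w p P < (q `^ p^-1)%:E)%E -> L f ->
  (knorm w p (P f) <= q%:E * knorm w p f)%E.
Proof.
move=> q0 opq Lf; have [mf ff] := (lorentz_spaceP w p0 f).1 Lf.
have mPf := Lsm (PL Lf).
have [n n0 nE] := ge0_fin_real (knorm_ge0 p ww f) ff.
case: pP => -[_ _ lin [C bd]] _.
(* A function of norm 0 cannot be normalized; there the constant [C] of boundedness shows that its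
   image has norm 0. *)
move: n0; rewrite le_eqVlt => /predU1P[n0|n0].
  have f0 : lorentz_norm w p f = 0%E.
    by rewrite lorentz_normE nE -n0 poweR_EFin powR0// gt_eqF// invr_gt0.
  have := bd f Lf; rewrite f0 mule0 => h.
  have -> : knorm w p (P f) = 0%E.
    apply/eqP; rewrite eq_le knorm_ge0// andbT leNgt; apply/negP => Pf0.
    have [_ fPf] := (lorentz_spaceP w p0 (P f)).1 (PL Lf).
    have [m m0 mE] := ge0_fin_real (knorm_ge0 p ww (P f)) fPf.
    have {}m0 : 0 < m by move: Pf0; rewrite mE lte_fin.
    have := @le_lorentz_norm R k w p ww p0 (P f) m (ltW m0).
    rewrite mE lexx => /(_ isT) /le_trans /(_ h).
    by rewrite lee_fin leNgt powR_gt0.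
  by rewrite nE -n0 mule0.
pose c : R := n^-1 `^ p^-1.
have c0 : 0 < c by rewrite powR_gt0// invr_gt0.
have cp : c `^ p = n^-1.
  by rewrite -powRrM mulVf ?gt_eqF// powRr1// invr_ge0 ltW.
pose cK := scalar_of k c.
have mc : modulus cK = c by rewrite modulus_scalar_of ger0_norm// ltW.
have cK0 : cK != 0.
  by apply/negP => /eqP h; move: c0; rewrite -mc h modulus0 ltxx.
(* The linearity clause speaks of combinations a f + g; writing c f as (c - 1) f + f brings it into
   this form with g = f. *)
have cfE : (fun t => (cK - 1) * f t + f t) = (fun t => cK * f t).
  by apply/funext => t; rewrite mulrBl mul1r subrK.
have Lcf : L (fun t => cK * f t) by rewrite -cfE; exact: L_lincomb.
have Pcf : ae_eq01 (P (fun t => cK * f t)) (fun t => cK * P f t).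
  rewrite -cfE; apply: (ae01_impl (lin (cK - 1) f f Lf Lf)) => u _ ->.
  by rewrite mulrBl mul1r subrK.
have n1 : knorm w p (fun t => cK * f t) = 1%E.
  by rewrite knormZ// mc cp nE -EFinM mulVf// gt_eqF.
have : (lorentz_norm w p (P (fun t => cK * f t)%R) < (q `^ p^-1)%:E)%E.
  apply: le_lt_trans opq; apply: ereal_sup_ubound; exists (fun t => cK * f t) => //.
  split => //; have := @ge_lorentz_norm R k w p ww p0 (fun t => cK * f t) 1 ler01.
  by rewrite n1 powR1; exact.
move/(lorentz_norm_lt ww p0 (ltW q0)).
rewrite (knorm_ae_eq ww p0 (Lsm (PL Lcf)) (measurable01_scale _ mPf) Pcf).
rewrite knormZ// mc cp nE => h.
have -> : knorm w p (P f) = (n%:E * (n^-1%:E * knorm w p (P f)))%E.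
  by rewrite muleA -EFinM mulfV ?gt_eqF// mul1e.
rewrite muleC; apply: lee_wpmul2r; [by rewrite lee_fin ltW|exact: ltW].
Qed.

(** The witness is g - P g for some g that [P] moves. Being nonzero, it also shows that constants
    have finite norm, which the approximation by step functions requires. *)
Lemma proj_kernel_nontrivial : ~ is_identity w p P ->
  exists f, [/\ L f, ae_eq01 (P f) (fun=> 0), (lnorm w p (fun=> 1%R) < +oo)%E &
    (0 < knorm w p f)%E].
Proof.
move=> /existsNP[g /not_implyP[Lg nPg]].
pose f t := -1 * P g t + g t.
have Lf : L f by exact: L_lincomb (PL Lg) Lg.
have mf := Lsm Lf; have mmf := measurable01_modulus mf.
have d0 : dist (fun u => modulus (f u)) 0 <> 0%E.
  move=> /(dist0_ae mmf) h; apply: nPg; apply: (ae01_impl h) => u _ /modulus_eq0.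
  by rewrite /f mulN1r => /eqP; rewrite addrC subr_eq0 => /eqP ->.
have [_ ff] := (lorentz_spaceP w p0 f).1 Lf.
exists f; split; first exact: Lf.
- exact: (proj_kernel Lg).
- exact: (lnorm1_lty ww p0 mmf d0 ff).
- exact: (lnorm_gt0 ww p0 mmf d0).
Qed.

Lemma proj_norm_ge (s q : R) : 0 < s -> s < 1 -> 1 < q ->
  (3 - s) `^ p + 3 * (1 + s) `^ p = (q ^+ 4)^-1 * (3 `^ p + 3) ->
  ~ is_identity w p P -> ((q `^ p^-1)%:E <= operator_norm w p P)%E.
Proof.
move=> s0 s1 q1 eqn nid; rewrite leNgt; apply/negP => opq.
have q0 : 0 < q by lra.
have [f [Lf Pf one fpos]] := proj_kernel_nontrivial nid.
have [mf ff] := (lorentz_spaceP w p0 f).1 Lf.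
have [n0 _ n0E] := ge0_fin_real (knorm_ge0 p ww f) ff.
have {fpos}n0p : 0 < n0 by move: fpos; rewrite n0E lte_fin.
(* The same [r] is the assumed bound on the norm of [P] and the main coefficient of the
   quasi-triangle inequalities, so each use costs r^p = q; [b'] is its conjugate, with 1/r + 1/b' =
   1. *)
pose r := q `^ p^-1.
have r1 : 1 < r.
  have := @gt0_ltr_powR R p^-1 _ 1 q.
  by rewrite powR1 !nnegrE; apply; rewrite ?invr_gt0//; lra.
have r0 : 0 < r by lra.
have rp : r `^ p = q by rewrite -powRrM mulVf ?gt_eqF// powRr1// ltW.
pose b' := r / (r - 1).
have b'0 : 0 < b' by rewrite divr_gt0// subr_gt0.
have rb : r^-1 + b'^-1 <= 1.
  by rewrite /b' invf_div (_ : _ + _ = 1)//; field; rewrite gt_eqF.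
pose b := b' `^ p; have b0 : 0 <= b by exact: powR_ge0.
pose c := 2 `^ p; have c0 : 0 < c by rewrite powR_gt0.
(* The tolerance is fixed before [F] and [y] are chosen: it depends only on the norm of [f], on [p]
   and on [q]. *)
pose e := n0 / (2 * (c * ((b + q * q * (b * (c * 2))) / (1 - q^-1) + 1))).
have e0 : 0 < e.
  have qV : 0 <= 1 - q^-1 by rewrite subr_ge0 invf_le1// ltW.
  rewrite divr_gt0// !mulr_gt0// ltr_wpDl//; apply: divr_ge0 => //.
  by apply: addr_ge0 => //; rewrite !mulr_ge0// ltW.
have [I [A [a [cA fA]]]] := knorm_approx ww p0 mf ff one e0.
have [B [y [qB Yy Hy]]] := rich_step ww p0 rY a cA e0.
pose F u := \sum_i a i * \1_(A i) u.
pose H := quarter_sum A B a.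
pose sK := scalar_of k (- s).
pose G u := H u + sK * F u.
pose U t := sK * f t + y t.
have Ly := LY Yy; have my := Lsm Ly.
have LU : L U by exact: L_lincomb.
have mU := Lsm LU.
have mF : measurable01 F by apply: measurable01_indic_sum; case: cA.
have mH : measurable01 H by exact: measurable01_quarter_sum.
have mG : measurable01 G.
  rewrite (_ : G = fun u => sK * F u + H u); first exact: measurable01_lincomb.
  by apply/funext => u; rewrite /G addrC.
have mfF := measurable01_sub mf mF.
have mHy := measurable01_sub mH my.
have {}Hy : (knorm w p (fun t => H t - y t)%R < e%:E)%E by exact: Hy.
have {}fA : (knorm w p (fun t => f t - F t)%R < e%:E)%E by exact: fA.
have PUy : knorm w p (P U) = knorm w p y.
  apply: (knorm_ae_eq ww p0 (Lsm (PL LU)) my); exact: proj_perturb.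
have hV : (knorm w p y <= q%:E * knorm w p U)%E.
  by rewrite -PUy; exact: knorm_proj_le.
have hX : (knorm w p H <= q%:E * knorm w p y + b%:E * knorm w p (fun t => H t - y t)%R)%E.
  rewrite -rp; apply: (knorm_quasi_triangle ww p0 r0 b'0 rb my mHy mH) => u _.
  by rewrite addrC subrK.
(* These are the two parts of U - G = (y - s f) - (H - s F): the error of richness and that of the
   step approximation. *)
pose E1 t := -1 * (H t - y t).
pose E2 t := sK * (f t - F t).
pose Er t := E1 t + E2 t.
have mE1 : measurable01 E1 by exact: (measurable01_scale (-1) mHy).
have mE2 : measurable01 E2 by exact: (measurable01_scale sK mfF).
have mEr : measurable01 Er by exact: (measurable01_lincomb (-1) mHy mE2).
have hU : (knorm w p U <= q%:E * knorm w p G + b%:E * knorm w p Er)%E.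
  rewrite -rp; apply: (knorm_quasi_triangle ww p0 r0 b'0 rb mG mEr mU) => u _.
  by rewrite /U /Er /E1 /E2 /G; ring.
have hEr : (knorm w p Er <= c%:E * (knorm w p E1 + knorm w p E2))%E.
  by apply: (knormD ww p0 mE1 mE2 mEr) => u _.
have hE1 : (knorm w p E1 < e%:E)%E.
  apply: (le_lt_trans (knorm_ae_le ww p0 mE1 mHy _) Hy); apply: aeW => u _.
  by rewrite /E1 mulN1r modulusN.
have hE2 : (knorm w p E2 < e%:E)%E.
  apply: (le_lt_trans (knorm_ae_le ww p0 mE2 mfF _) fA); apply: aeW => u _.
  have sKE : modulus sK = s by rewrite modulus_scalar_of normrN gtr0_norm.
  have -> : modulus (E2 u) = s * modulus (f u - F u) by rewrite -sKE; exact: modulusM.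
  exact: ler_piMl (modulus_ge0 _) (ltW s1).
have hG : (knorm w p G <= ((q ^+ 4)^-1)%:E * knorm w p H)%E.
  have k0 : 0 < (q ^+ 4)^-1 by rewrite invr_gt0 exprn_gt0.
  have k1 : (q ^+ 4)^-1 <= 1.
    have q4 : 1 <= q ^+ 4 by apply: exprn_ege1; exact: ltW.
    by rewrite invf_le1 ?exprn_gt0.
  exact: (knorm_shift_le a cA qB s0 s1 k0 k1 eqn).
have hF : (knorm w p F <= knorm w p H)%E by exact: knorm_indic_sum_le.
have hn : (knorm w p f <= c%:E * (knorm w p F + knorm w p (fun t => f t - F t)%R))%E.
  by apply: (knormD ww p0 mF mfF mf) => u _; rewrite addrC subrK.
(* The norms are turned into real numbers one by one: [y] and [U] lie in the space, and every other
   norm is finite by an inequality that bounds it. *)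
have [_ fy] := (lorentz_spaceP w p0 y).1 Ly.
have [_ fU] := (lorentz_spaceP w p0 U).1 LU.
have [V V0 VE] := ge0_fin_real (knorm_ge0 p ww y) fy.
have [Un U0 UE] := ge0_fin_real (knorm_ge0 p ww U) fU.
have [h1 _ h1E] :=
  ge0_fin_real (knorm_ge0 p ww (fun t => H t - y t)) (lt_trans Hy (ltry _)).
have [h2 _ h2E] :=
  ge0_fin_real (knorm_ge0 p ww (fun t => f t - F t)) (lt_trans fA (ltry _)).
have [x1 _ x1E] := ge0_fin_real (knorm_ge0 p ww E1) (lt_trans hE1 (ltry _)).
have [x2 _ x2E] := ge0_fin_real (knorm_ge0 p ww E2) (lt_trans hE2 (ltry _)).
rewrite VE h1E -!EFinM -EFinD in hX.
have [X _ XE] := ge0_fin_real (knorm_ge0 p ww H) (le_lt_trans hX (ltry _)).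
have hFy : (knorm w p F < +oo)%E.
  by apply: (le_lt_trans hF); rewrite XE; exact: ltry.
have [Fn _ FE] := ge0_fin_real (knorm_ge0 p ww F) hFy.
rewrite XE -EFinM in hG.
have [Gn _ GE] := ge0_fin_real (knorm_ge0 p ww G) (le_lt_trans hG (ltry _)).
rewrite x1E x2E -EFinD -EFinM in hEr.
have [x3 _ x3E] := ge0_fin_real (knorm_ge0 p ww Er) (le_lt_trans hEr (ltry _)).
rewrite x1E lte_fin in hE1; rewrite x2E lte_fin in hE2.
rewrite x3E lee_fin in hEr.
rewrite n0E FE h2E -EFinD -EFinM lee_fin in hn.
rewrite h1E lte_fin in Hy; rewrite h2E lte_fin in fA.
rewrite XE lee_fin in hX; rewrite GE lee_fin in hG; rewrite FE XE lee_fin in hF.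
rewrite VE UE -EFinM lee_fin in hV.
rewrite UE GE x3E -!EFinM -EFinD lee_fin in hU.
exact: (perturbation_absurd q1 c0 b0 n0p erefl hn hF hX hV hU hEr hG Hy fA hE1 hE2).
Qed.
End Projection.
End NarrowPerturbation.

Theorem theorem3p1 (R : realType) (p : R) (hp : 2 < p) :
  exists rho : R, 1 < rho /\
    forall (k : scalar_kind) (w : R -> R), lorentz_weight w ->
    forall (Y : set (R -> scalar_field R k))
           (P : (R -> scalar_field R k) -> (R -> scalar_field R k)),
      rich_subspace w p Y ->
      is_projection w p P ->
      has_range w p P Y ->
      ~ is_identity w p P ->
      (rho%:E <= operator_norm w p P)%E.
Proof.
have [s [q [s0 s1 q1 eqn]]] := contraction_constants hp.
have p0 : 0 < p by lra.
(* The root converts the gain [q] on p-th powers into one on norms; [q] is fixed before the scalars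
   and the weight are introduced. *)
exists (q `^ p^-1); split.
  have := @gt0_ltr_powR R p^-1 _ 1 q.
  by rewrite powR1 !nnegrE; apply; rewrite ?invr_gt0//; lra.
move=> k w ww Y P rY pP YP nid.
exact: (proj_norm_ge ww p0 rY pP YP s0 s1 q1 eqn nid).
Qed.
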